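(* Let $T>0$, $\omega>0$, $\sigma>0$, and let $H:\mathbb{R}\times[0,T)\to(0,\infty)$ be a smooth function satisfying $\partial_tH(x,t)+\frac12\partial_{xx}H(x,t)=0$. Let $\mathcal{Z}_t$ be the observation process. The un-normalised Zakai filter $\psi(x,t\mid\mathcal{Z}_\tau)$ of the Brownian-motion filtering problem (zero drift), which obeys $$d\psi=\frac12\,\partial_{xx}\psi\,dt+\frac{\omega x}{\sigma^2}\,\psi\,d\mathcal{Z}_t,$$ and the un-normalised Zakai filter $\hat\psi(x,t\mid\mathcal{Z}_\tau)$ of the filtering problem with drift $\partial_x\ln H(x,t)$, which obeys $$d\hat\psi=-\partial_x\left\{\left[\partial_x\ln H(x,t)\right]\hat\psi\right\}dt+\frac12\,\partial_{xx}\hat\psi\,dt+\frac{\omega x}{\sigma^2}\,\hat\psi\,d\mathcal{Z}_t,$$ are related by $$\hat\psi(x,t\mid\mathcal{Z}_\tau)=H(x,t)\,\psi(x,t\mid\mathcal{Z}_\tau);$$ that is, if $\psi$ solves the first equation, then $H\psi$ solves the second one (with the same observation process $\mathcal{Z}$).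
   Context: The filtering problem with drift $g(x,t)$ is: the system evolves as $dX_t=g(X_t,t)\,dt+dW_{1,t}$, $X_0=x_0$, and is monitored through $d\mathcal{Z}_t=\omega X_t\,dt+\sigma\,dW_{2,t}$, $\mathcal{Z}_0=x_0$, with $W_1,W_2$ independent standard Brownian motions. The conditional density of $X_t$ given the observations $\mathcal{Z}_\tau$, $\tau\in[0,t]$, is $\varphi=\psi/\int_{\mathbb{R}}\psi\,dx$, where the un-normalised filter $\psi$ solves the Zakai equation $d\psi=\left(-\partial_x[g\psi]+\frac12\partial_{xx}\psi\right)dt+\frac{\omega x}{\sigma^2}\psi\,d\mathcal{Z}_t$ (Itô sense). Un-normalised filters are defined only up to a positive multiplicative constant. ''Solution'' means a random field that, for $t>0$, is twice continuously differentiable in $x$ and for each $x$ is a continuous semimartingale in $t$ satisfying the equation. *)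

(* Defs.v *)
From HB Require Import structures.
From mathcomp Require Import all_boot all_order all_algebra.
From mathcomp Require Import all_classical all_reals all_analysis.
Set Implicit Arguments.
Unset Strict Implicit.
Unset Printing Implicit Defensive.
Import Order.TTheory GRing.Theory Num.Theory.
Import numFieldNormedType.Exports.
Local Open Scope classical_set_scope.
Local Open Scope ring_scope.

Section Processes.
Context {R : realType} {d : measure_display} {Omega : measurableType d}.
Variable P : probability Omega R.

(* Time is a real number; only times t >= 0 matter.  A process is a function
   of time and outcome.  Processes need only be given on part of the time axis,
   and every predicate below says on which part it looks at them. *)
Implicit Types (F G : R -> set (set Omega)) (X Z M A K J : R -> Omega -> R).

Definition usual_filtration F : Prop :=
  [/\ forall t, 0 <= t -> sigma_algebra setT (F t) /\ F t `<=` measurable,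
      forall s t, 0 <= s -> s <= t -> F s `<=` F t,
      forall t, 0 <= t -> \bigcap_(u in [set u | t < u]) F u = F t
    & forall N : set Omega, P.-negligible N -> F 0 N].

Definition measurable_wrt (S : set (set Omega)) (f : Omega -> R) : Prop :=
  forall B : set R, measurable B -> S (f @^-1` B).

Definition adapted_on F (D : set R) X : Prop :=
  forall t, D t -> measurable_wrt (F t) (X t).

Definition continuous_paths_on (D : set R) X : Prop :=
  {ae P, forall w : Omega, {within D, continuous (fun t => X t w)}}.

Definition brownian_motion F (W : R -> Omega -> R) : Prop :=
  [/\ adapted_on F `[0, +oo[ W,
      continuous_paths_on `[0, +oo[ W,
      {ae P, forall w, W 0 w = 0}
    & forall s t, 0 <= s -> s < t ->
      forall (A : set Omega) (B : set R), F s A -> measurable B ->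
        P (A `&` [set w | B (W t w - W s w)]) =
        (P A * normal_prob 0 (Num.sqrt (t - s)) B)%E].

Definition process_sigma_algebra X : set (set Omega) :=
  <<s [set A : set Omega | exists (t : R) (B : set R), [/\ 0 <= t, measurable B & A = X t @^-1` B]] >>.

Definition independent_processes (X Y : R -> Omega -> R) : Prop :=
  forall A B : set Omega, process_sigma_algebra X A -> process_sigma_algebra Y B ->
    P (A `&` B) = (P A * P B)%E.

(* X is a signal with drift g observed through Z, on the time interval [0, T[;
   F is a filtration for which W1 and W2 are Brownian motions. *)
Definition filtering_problem F (T omega sigma x0 : R) (g : R -> R -> R)
    (W1 W2 X Z : R -> Omega -> R) : Prop :=
  [/\ [/\ brownian_motion F W1, brownian_motion F W2
        & independent_processes W1 W2],
      adapted_on F `[0, T[ X /\ continuous_paths_on `[0, T[ X,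
      {ae P, forall w, forall t, 0 <= t < T ->
        lebesgue_measure.-integrable `[0, t] (fun s => (g (X s w) s)%:E) /\
        X t w = x0 + \int[lebesgue_measure]_(s in `[0, t]) g (X s w) s
                + W1 t w}
    & {ae P, forall w, forall t, 0 <= t < T ->
        Z t w = x0 + \int[lebesgue_measure]_(s in `[0, t]) (omega * X s w)
                + sigma * W2 t w}].

Definition martingale_on F (a T : R) M : Prop :=
  [/\ adapted_on F `[a, T[ M,
      forall t, a <= t < T -> P.-integrable setT (fun w => (M t w)%:E)
    & forall s t, a <= s -> s <= t -> t < T -> forall A : set Omega, F s A ->
        (\int[P]_(w in A) (M t w)%:E = \int[P]_(w in A) (M s w)%:E)%E].

Definition stopping_time_on F (a T : R) (tau : Omega -> R) : Prop :=
  (forall w, a <= tau w) /\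
  forall t, a <= t < T -> F t [set w | tau w <= t].

Definition continuous_local_martingale_on F (a T : R) M : Prop :=
  [/\ adapted_on F `[a, T[ M,
      continuous_paths_on `[a, T[ M
    & exists tau : nat -> Omega -> R,
      [/\ forall n, stopping_time_on F a T (tau n),
          forall n w, tau n w <= tau n.+1 w,
          {ae P, forall w, forall b, b < T -> exists n, b < tau n w}
        & forall n, martingale_on F a T
            (fun t w => M (Num.min t (tau n w)) w)]].

Definition finite_variation_on F (a T : R) A : Prop :=
  [/\ adapted_on F `[a, T[ A,
      continuous_paths_on `[a, T[ A
    & {ae P, forall w, forall b, a <= b < T ->
        bounded_variation a b (fun t => A t w)}].

(* The parts M and A start at 0. *)
Definition continuous_semimartingale_on F (a T : R) X : Prop :=
  [/\ adapted_on F `[a, T[ X,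
      continuous_paths_on `[a, T[ X
    & exists M A,
      [/\ continuous_local_martingale_on F a T M,
          finite_variation_on F a T A,
          {ae P, forall w, M a w = 0 /\ A a w = 0}
        & {ae P, forall w, forall t, a <= t < T ->
            X t w = X a w + M t w + A t w}]].

(* Simple integrand \sum_i coef_i 1_{]left_i, right_i]}; the intervals may
   overlap. *)
Record simple_integrand := SimpleIntegrand {
  simple_size : nat;
  simple_left : nat -> R;
  simple_right : nat -> R;
  simple_coef : nat -> Omega -> R }.

Definition simple_predictable F (a b : R) (S : simple_integrand) : Prop :=
  forall i, (i < simple_size S)%N ->
    [/\ a <= simple_left S i, simple_left S i <= simple_right S i,
        simple_right S i <= b
      & measurable_wrt (F (simple_left S i)) (simple_coef S i)].

Definition simple_process (S : simple_integrand) (t : R) (w : Omega) : R :=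
  \sum_(i < simple_size S)
    simple_coef S i w * ((simple_left S i < t) && (t <= simple_right S i))%:R.

Definition simple_integral (S : simple_integrand) Z (t : R) (w : Omega) : R :=
  \sum_(i < simple_size S)
    simple_coef S i w * (Z (Num.min (simple_right S i) t) w
                         - Z (Num.min (simple_left S i) t) w).

(* Uniform convergence on ]a, b] in probability.  The exceptional event is
   measured from outside, so its measurability is not presupposed. *)
Definition ucp_cvg (a b : R) (Y : nat -> R -> Omega -> R) X : Prop :=
  forall e delta : R, 0 < e -> 0 < delta ->
    \forall n \near \oo, exists2 B : set Omega,
      measurable B /\ (P B <= delta%:E)%E
      & [set w | exists2 t, a < t <= b & e <= `|Y n t w - X t w|] `<=` B.

(* J_t = \int_a^t K_s dZ_s (Ito) for t in [a, T[, where K is a continuous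
   adapted integrand and Z a continuous semimartingale: the ucp-continuous
   extension of the elementary integral of simple integrands. *)
Definition ito_integral_on F (a T : R) K Z J : Prop :=
  [/\ adapted_on F `[a, T[ K /\ continuous_paths_on `[a, T[ K,
      adapted_on F `[a, T[ J /\ continuous_paths_on `[a, T[ J
    & forall b, a < b < T ->
      exists S : nat -> simple_integrand,
        [/\ forall n, simple_predictable F a b (S n),
            ucp_cvg a b (fun n => simple_process (S n)) K
          & ucp_cvg a b (fun n => simple_integral (S n) Z) J]].

(* A random field is given by its values psi x t w. *)
Implicit Types psi : R -> R -> Omega -> R.

(* - d/dx [g psi] + 1/2 d^2/dx^2 psi *)
Definition zakai_drift (g : R -> R -> R) psi (x t : R) (w : Omega) : R :=
  - derive1 (fun y => g y t * psi y t w) x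
  + 2^-1 * derive1 (derive1 (fun y => psi y t w)) x.

Definition twice_continuously_differentiable (f : R -> R) : Prop :=
  [/\ forall x, derivable f x 1,
      forall x, derivable (derive1 f) x 1
    & continuous (derive1 (derive1 f))].

(* The equation is imposed on [a, T[ for every a in ]0, T[, and not from time
   0, because the initial law of the signal is a point mass. *)
Definition zakai_solution F (T omega sigma : R) (g : R -> R -> R) Z psi
    : Prop :=
  [/\ {ae P, forall w, forall t, 0 < t < T ->
        twice_continuously_differentiable (fun x => psi x t w)},
      forall x a, 0 < a < T -> continuous_semimartingale_on F a T (psi x)
    & forall x a, 0 < a < T -> exists J,
        ito_integral_on F a T
          (fun t w => omega * x / sigma ^+ 2 * psi x t w) Z J /\
        {ae P, forall w, forall t, a <= t < T ->
          lebesgue_measure.-integrable `[a, t]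
            (fun s => (zakai_drift g psi x s w)%:E) /\
          psi x t w = psi x a w
            + \int[lebesgue_measure]_(s in `[a, t]) zakai_drift g psi x s w
            + J t w}].

End Processes.

(* C^oo on R x [0, T[, including the boundary t = 0: D i j is the derivative
   taken i times in x and j times in t.  At t = 0 the t-derivatives are the
   continuous extensions from t > 0, hence the one-sided derivatives. *)
Definition smooth_on_strip {R : realType} (T : R) (H : R -> R -> R) : Prop :=
  exists D : nat -> nat -> R -> R -> R,
    [/\ forall x t : R, 0 <= t < T -> D 0%N 0%N x t = H x t,
        forall i j, {within [set p : R * R | 0 <= p.2 < T],
                     continuous (fun p : R * R => D i j p.1 p.2)},
        forall i j (x t : R), 0 <= t < T ->
          is_derive x (1 : R) (fun y => D i j y t) (D i.+1 j x t)
      & forall i j (x t : R), 0 < t < T ->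
          is_derive t (1 : R) (fun s => D i j x s) (D i j.+1 x t)].

(* Main.v *)
(** Write h = H x and h' for its time derivative.  The product rule for
    d(h psi), the heat equation and the identity
    - dx[(dx ln H) H psi] + 1/2 dxx(H psi) = - 1/2 (dxx H) psi + H (1/2 dxx psi)
    give formally d(H psi) = (drift) dt + h K dZ, so the point is to make
    sense of \int h dJ for J = \int K dZ.  As h is deterministic and C^1,
    this integral is h J - \int h' J ds pathwise.  The same expression applied
    to the martingale part M of psi is a local martingale: by Fubini,
    E[1_A \int_s^t h' M du] = (h t - h s) E[1_A M_s].  Applied to J it is the Ito
    integral of h K: multiply the simple integrands approximating K by step
    approximations of h; their integrals are Riemann-Stieltjes sums of h
    against simple integrals, and summation by parts bounds them by the
    supremum of the integrator uniformly in the mesh. *)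

(* The only facts used about [h] in time are that it is bounded and Lipschitz on segments and that
   its increments are integrals of a continuous [dh]; [primitive_on] packages them. The equation is
   read from a time [a > 0], so the one-sided derivatives at time 0 never enter. Two obstacles shape
   the rest. Paths are continuous only almost surely, whereas Fubini and measurability of a time
   integral need a jointly measurable integrand on a whole product space; this explains the
   retraction onto a segment and the passage to modifications. And the approximation of an Ito
   integral carries an index [n] of its own: because the bound on mesh sums does not depend on the
   mesh, the [n]-th simple integrand can be paired with the [n]-th mesh, and no double limit
   arises. *)
Require Import Defs.
From HB Require Import structures.
From mathcomp Require Import all_boot all_order all_algebra.
From mathcomp Require Import all_classical all_reals all_analysis.
From mathcomp Require Import measurable_realfun.
From mathcomp Require Import ring lra.
Set Implicit Arguments.
Unset Strict Implicit.
Unset Printing Implicit Defensive.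
Import Order.TTheory GRing.Theory Num.Theory.
Import numFieldNormedType.Exports.
Local Open Scope classical_set_scope.
Local Open Scope ring_scope.

(** * Continuity and Lebesgue integration on a segment *)

Section SegmentCalculus.
Context {R : realType}.
Local Notation mu := (@lebesgue_measure R).
Implicit Types (f g h dh phi : R -> R) (a b : R).

Lemma within_continuousP (A : set R) f :
  {within A, continuous f} <->
  forall x, A x -> forall e : R, 0 < e ->
    exists2 d : R, 0 < d & forall y, A y -> `|x - y| < d -> `|f x - f y| < e.
Proof.
rewrite subspace_continuousP; split => cf x Ax.
  move=> e e0; have /cvgrPdist_lt /(_ _ e0) := cf _ Ax.
  by rewrite near_withinE => -[d /= d0 H]; exists d => // y Ay xy; exact: H.
apply/cvgrPdist_lt => e e0; rewrite near_withinE.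
have [d d0 H] := cf _ Ax _ e0; exists d => //= y xy Ay; exact: H.
Qed.

Lemma segment_uniform_continuous a b f : {within `[a, b], continuous f} ->
  forall e : R, 0 < e -> exists2 d : R, 0 < d &
    forall x y, a <= x <= b -> a <= y <= b -> `|x - y| < d -> `|f x - f y| < e.
Proof.
move=> /within_continuousP cf e e0.
(* Heine-Cantor by the near-covering form of compactness; the filter parameter is the modulus [d],
   tending to 0 from the right. *)
have /compact_near_coveringP/near_covering_withinP/(_ R 0^'+
  (fun d x => forall y, a <= y <= b -> `|x - y| < d -> `|f x - f y| < e)) :=
  @segment_compact R a b.
case.
  move=> x /= xab; have [|d d0 H] := cf x xab (e / 2); first by rewrite divr_gt0.
  exists (ball x (d / 2), [set t | t < d / 2]) => /=.
    split; first by apply: nbhsx_ballx; rewrite divr_gt0.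
    by apply: nbhs_right_lt; rewrite divr_gt0.
  move=> [z t] /= [] xz td zab y yab zyt.
  have Hz : `|f x - f z| < e / 2.
    by apply: H => //; apply: (lt_trans xz); rewrite ltr_pdivrMr// ltr_pMr// ltr1n.
  have Hy : `|f x - f y| < e / 2.
    apply: H => //=; rewrite [d]splitr.
    by apply: (le_lt_trans (ler_distD z _ _)); apply: ltrD => //; exact: (lt_trans zyt).
  rewrite [e]splitr; apply: (le_lt_trans (ler_distD (f x) _ _)).
  by apply: ltrD => //; rewrite distrC.
move=> d /= d0 H.
exists (d / 2); first by rewrite divr_gt0.
move=> x y xab yab; apply: (H (d / 2)) => //=; last by rewrite divr_gt0.
by rewrite sub0r normrN gtr0_norm ?divr_gt0// ltr_pdivrMr// ltr_pMr// ltr1n.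
Qed.

Lemma segment_bounded a b f : {within `[a, b], continuous f} ->
  exists2 C : R, 0 < C & forall x, a <= x <= b -> `|f x| <= C.
Proof.
move=> cf.
have /compact_bounded[M [_ MP]] := continuous_compact cf (@segment_compact R a b).
exists (`|M| + 1); first by rewrite ltr_wpDl.
move=> x xab; apply: MP; last by exists x.
by rewrite (le_lt_trans (ler_norm M))// ltrDl.
Qed.

Lemma sub_segment a b u v : a <= u -> v <= b -> `[u, v] `<=` `[a, b].
Proof.
move=> au vb x /=; rewrite !in_itv/= => /andP[ux xv].
by rewrite (le_trans au ux) (le_trans xv vb).
Qed.

Lemma sub_segment_co a T u v : a <= u -> v < T -> `[u, v] `<=` `[a, T[.
Proof.
move=> au vT x /=; rewrite !in_itv/= => /andP[ux xv].
by rewrite (le_trans au ux) (le_lt_trans xv vT).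
Qed.

Lemma segment_integrable a b f : {within `[a, b], continuous f} ->
  mu.-integrable `[a, b] (EFin \o f).
Proof.
by move=> cf; apply: continuous_compact_integrable => //; exact: segment_compact.
Qed.

Lemma integrable_subsegment a b u v f : a <= u -> v <= b ->
  mu.-integrable `[a, b] (EFin \o f) -> mu.-integrable `[u, v] (EFin \o f).
Proof. by move=> au vb fi; apply: integrableS fi => //; exact: sub_segment. Qed.

Lemma segment_integrableM a b f phi : {within `[a, b], continuous f} ->
  mu.-integrable `[a, b] (EFin \o phi) ->
  mu.-integrable `[a, b] (EFin \o (fun s => f s * phi s)).
Proof.
move=> cf iphi.
have := @integrableMr _ _ R mu `[a, b] (measurable_itv _) f (EFin \o phi).
apply => //.
- by apply: subspace_continuous_measurable_fun => //; exact: measurable_itv.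
- have [C _ HC] := segment_bounded cf.
  by exists C; split => [|M CM x /= xab]; [exact: num_real|exact: le_trans (HC _ xab) (ltW CM)].
Qed.

Lemma Rintegral_cat u v w f : u <= v -> v <= w ->
  mu.-integrable `[u, w] (EFin \o f) ->
  \int[mu]_(s in `[u, w]) f s =
  \int[mu]_(s in `[u, v]) f s + \int[mu]_(s in `[v, w]) f s.
Proof.
move=> uv vw fi.
have H := Rintegral_itvB fi (x := v).
(* The two closed segments share the null point [v], which is dropped from the second one. *)
rewrite -(@Rintegral_itv_obnd_cbnd _ v); last first.
  apply: (integrableS _ _ _ fi) => //.
  by move=> x /=; rewrite !in_itv/= => /andP[/ltW vx ->]; rewrite (le_trans uv vx).
by rewrite -H ?bnd_simp// addrC subrK.
Qed.

Lemma ler_Rintegral_segment u v f C : u <= v ->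
  mu.-integrable `[u, v] (EFin \o f) ->
  (forall s, u <= s <= v -> `|f s| <= C) ->
  `|\int[mu]_(s in `[u, v]) f s| <= C * (v - u).
Proof.
move=> uv fi fC.
apply: (le_trans (le_normr_Rintegral _ fi)) => //.
have -> : C * (v - u) = \int[mu]_(s in `[u, v]) C.
  rewrite Rintegral_cst//= lebesgue_measure_itv/= lte_fin.
  case: ltP => //= vu; have -> : v = u by apply/eqP; rewrite eq_le uv vu.
  by rewrite subrr.
apply: le_Rintegral => //.
- by apply: (integrable_norm fi).
- by apply: segment_integrable; apply: continuous_subspaceT => ?; exact: cvg_cst.
Qed.

Lemma within_continuousM (A : set R) f g : {within A, continuous f} ->
  {within A, continuous g} -> {within A, continuous (fun s => f s * g s)}.
Proof.
move=> /subspace_continuousP cf /subspace_continuousP cg.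
by apply/subspace_continuousP => x Ax; apply: cvgM; [exact: cf|exact: cg].
Qed.

End SegmentCalculus.

(** * Pathwise integration by parts against a continuous path *)

Section PartsIntegral.
Context {R : realType}.
Local Notation mu := (@lebesgue_measure R).
Implicit Types (f g h dh phi : R -> R) (a b : R).

(** The C^1 condition in its integrated form: no derivative at an endpoint is mentioned, and
    restriction to subsegments is immediate. *)
Definition primitive_on a b h dh := {within `[a, b], continuous dh} /\
  forall u v, a <= u -> u <= v -> v <= b ->
    \int[mu]_(s in `[u, v]) dh s = h v - h u.

(* The integral of h against df over [a, t], plus the boundary term h a * f a,
   written by parts so that it makes sense for every continuous f. *)
Definition parts_int a h dh f (t : R) : R :=
  h t * f t - \int[mu]_(s in `[a, t]) (dh s * f s).

Lemma primitive_onS a b u v h dh : a <= u -> v <= b ->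
  primitive_on a b h dh -> primitive_on u v h dh.
Proof.
move=> au vb [cdh ih]; split.
  by apply: continuous_subspaceW cdh; exact: sub_segment.
by move=> x y ux xy yv; apply: ih => //; [exact: le_trans ux|exact: le_trans vb].
Qed.

Lemma lipschitz_within_continuous a b f C :
  (forall u v, a <= u -> u <= v -> v <= b -> `|f v - f u| <= C * (v - u)) ->
  {within `[a, b], continuous f}.
Proof.
move=> fC; apply/within_continuousP => x /= ; rewrite in_itv/= => /andP[ax xb] e e0.
have C0 : 0 < `|C| + 1 by rewrite ltr_wpDl.
exists (e / (`|C| + 1)); first by rewrite divr_gt0.
move=> y; rewrite in_itv/= => /andP[ay yb]; rewrite ltr_pdivlMr// => xy.
have H u v : a <= u -> u <= v -> v <= b -> `|f v - f u| <= `|u - v| * (`|C| + 1).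
  move=> au uv vb; apply: (le_trans (fC _ _ au uv vb)).
  rewrite distrC ger0_norm ?subr_ge0// mulrC ler_wpM2l ?subr_ge0//.
  by rewrite (le_trans (ler_norm C))// lerDl.
apply: le_lt_trans xy.
have [xy|/ltW yx] := leP x y; first by rewrite distrC H.
by rewrite (distrC x) H.
Qed.

Lemma primitive_lipschitz a b h dh : primitive_on a b h dh ->
  exists2 C : R, 0 < C &
    forall u v, a <= u -> u <= v -> v <= b -> `|h v - h u| <= C * (v - u).
Proof.
move=> [cdh ih]; have [C C0 HC] := segment_bounded cdh; exists C => // u v au uv vb.
rewrite -ih//; apply: ler_Rintegral_segment => //.
  by apply: (integrable_subsegment au vb); exact: segment_integrable.
by move=> s /andP[us sv]; apply: HC; rewrite (le_trans au us) (le_trans sv vb).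
Qed.

Lemma primitive_continuous a b h dh : primitive_on a b h dh ->
  {within `[a, b], continuous h}.
Proof. by move=> /primitive_lipschitz[C _]; exact: lipschitz_within_continuous. Qed.

Lemma parts_intxx a h dh f : parts_int a h dh f a = h a * f a.
Proof. by rewrite /parts_int set_itv1 Rintegral_set1 subr0. Qed.

Lemma within_continuous_itvco a T f :
  (forall b, a <= b < T -> {within `[a, b], continuous f}) ->
  {within `[a, T[, continuous f}.
Proof.
move=> cf; apply/within_continuousP => x /=; rewrite in_itv/= => /andP[ax xT] e e0.
(* The midpoint of [x] and [T] ends a closed segment that contains a neighbourhood of [x] relative
   to the half-open interval. *)
have xm : x < (x + T) / 2 by rewrite midf_lt.
have mT : (x + T) / 2 < T by rewrite midf_lt.
have /within_continuousP /(_ x) := cf ((x + T) / 2) (introT andP (conj (le_trans ax (ltW xm)) mT)).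
rewrite /= in_itv/= ax (ltW xm) => /(_ isT e e0)[d d0 H].
exists (Num.min d ((x + T) / 2 - x)); first by rewrite lt_min d0 subr_gt0.
move=> y; rewrite /= in_itv/= => /andP[ay _]; rewrite lt_min => /andP[xyd xym].
apply: H => //; rewrite in_itv/= ay/=.
have := le_lt_trans (ler_norm (y - x)); rewrite distrC => /(_ _ xym).
by rewrite ltrD2r => /ltW.
Qed.

(** Freezing [h] at the left end leaves an error of order [v - u] times the oscillation of [f] on
    the segment. Convergence of mesh sums, compatibility with stopping and integration by parts all
    rest on this. *)
Lemma parts_int_increment a b h dh f u v : primitive_on a b h dh ->
  {within `[a, b], continuous f} -> a <= u -> u <= v -> v <= b ->
  parts_int a h dh f v - parts_int a h dh f u =
  h u * (f v - f u) + \int[mu]_(s in `[u, v]) (dh s * (f v - f s)).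
Proof.
move=> [cdh ih] cf au uv vb.
have cdf := within_continuousM cdh cf.
rewrite /parts_int (@Rintegral_cat _ a u v)//; last first.
  by apply: (integrable_subsegment (lexx a) vb); exact: segment_integrable.
have -> : \int[mu]_(s in `[u, v]) (dh s * (f v - f s)) =
    (h v - h u) * f v - \int[mu]_(s in `[u, v]) (dh s * f s).
  rewrite -ih// -RintegralZr//; last first.
    by apply: (integrable_subsegment au vb); exact: segment_integrable.
  rewrite -RintegralB//.
  - by apply: eq_Rintegral => s _; rewrite mulrBr.
  - apply: (integrable_subsegment au vb); apply: segment_integrable.
    by apply: within_continuousM => //; apply: continuous_subspaceT => ?; exact: cvg_cst.
  - by apply: (integrable_subsegment au vb); exact: segment_integrable.
ring.
Qed.

Lemma parts_int_integral_lipschitz a b dh f : {within `[a, b], continuous dh} ->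
  {within `[a, b], continuous f} -> exists2 C : R, 0 < C &
    forall u v, a <= u -> u <= v -> v <= b ->
      `|\int[mu]_(s in `[a, v]) (dh s * f s) - \int[mu]_(s in `[a, u]) (dh s * f s)|
         <= C * (v - u).
Proof.
move=> cdh cf; have cdf := within_continuousM cdh cf.
have [C C0 HC] := segment_bounded cdf; exists C => // u v au uv vb.
rewrite (@Rintegral_cat _ a u v)//; last first.
  by apply: (integrable_subsegment (lexx a) vb); exact: segment_integrable.
rewrite addrAC subrr add0r; apply: ler_Rintegral_segment => //.
  by apply: (integrable_subsegment au vb); exact: segment_integrable.
by move=> s /andP[us sv]; apply: HC; rewrite (le_trans au us) (le_trans sv vb).
Qed.

Lemma parts_int_continuous a b h dh f : primitive_on a b h dh ->
  {within `[a, b], continuous f} ->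
  {within `[a, b], continuous (parts_int a h dh f)}.
Proof.
move=> hdh cf; apply: within_continuousB.
  by apply: within_continuousM => //; exact: primitive_continuous hdh.
have [C _ HC] := parts_int_integral_lipschitz hdh.1 cf.
exact: lipschitz_within_continuous HC.
Qed.

Lemma within_continuous_min (D : set R) f tau :
  (forall x, D x -> D (Num.min x tau)) -> {within D, continuous f} ->
  {within D, continuous (fun s => f (Num.min s tau))}.
Proof.
move=> Dtau /within_continuousP cf; apply/within_continuousP => x Dx e e0.
have [|d d0 H] := cf (Num.min x tau) _ e e0; first exact: Dtau.
exists d => // y Dy xy; apply: H => /=; first exact: Dtau.
apply: le_lt_trans xy.
case: (leP x tau) => xt; case: (leP y tau) => yt //; last by rewrite subrr normr0.
  have xy : x <= y by exact: le_trans (ltW yt).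
  by rewrite ler0_norm ?subr_le0// ler0_norm ?subr_le0//; lra.
have yx : y <= x by exact: le_trans (ltW xt).
by rewrite ger0_norm ?subr_ge0// ger0_norm ?subr_ge0//; lra.
Qed.

(** The stopped path is constant after [tau], so both terms of the increment formula over [[tau, t]]
    vanish. Hence a sequence localising [M] also localises its transform. *)
Lemma parts_int_stop a b h dh f t tau : primitive_on a b h dh ->
  {within `[a, b], continuous f} -> a <= t <= b -> a <= tau ->
  parts_int a h dh (fun s => f (Num.min s tau)) t =
  parts_int a h dh f (Num.min t tau).
Proof.
move=> hdh cf /andP[at_ tb] atau.
have [ttau|taut] := leP t tau.
  rewrite /parts_int (min_idPl ttau); congr (_ - _); apply: eq_Rintegral => s.
  rewrite inE/= in_itv/= => /andP[_ st].
  by rewrite (min_idPl (le_trans st ttau)).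
have taub := le_trans (ltW taut) tb.
have cfm : {within `[a, b], continuous (fun s => f (Num.min s tau))}.
  apply: within_continuous_min cf => x /=; rewrite !in_itv/= => /andP[ax xb].
  by rewrite le_min ax atau ge_min xb.
have := parts_int_increment hdh cfm atau (ltW taut) tb.
rewrite (_ : \int[mu]_(s in `[tau, t]) _ = 0); last first.
  rewrite (@eq_Rintegral _ _ _ _ _ (fun=> 0)) ?Rintegral_cst ?mul0r//.
  move=> s; rewrite inE/= in_itv/= => /andP[taus st].
  by rewrite (min_idPr (ltW taut)) (min_idPr taus) subrr mulr0.
rewrite (min_idPr (ltW taut)) minxx subrr mulr0 addr0 => /eqP.
rewrite subr_eq0 => /eqP ->.
rewrite /parts_int minxx; congr (_ - _); apply: eq_Rintegral => s.
by rewrite inE/= in_itv/= => /andP[_ st]; rewrite (min_idPl st).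
Qed.

(** Summed over a partition, the right-hand side is [C] times the variation of [g] plus [D] times
    that of the identity, which is [b - a] by monotonicity. *)
Lemma bounded_variation_increments a b f g C D : a <= b -> 0 <= C -> 0 <= D ->
  bounded_variation a b g ->
  (forall u v, a <= u -> u <= v -> v <= b ->
     `|f v - f u| <= C * `|g v - g u| + D * (v - u)) ->
  bounded_variation a b f.
Proof.
move=> ab C0 D0 [M gM] fg; exists (C * M + D * (b - a)) => _ [s abs <-].
have : variation a b f s <= C * variation a b g s + D * variation a b id s.
  rewrite /variation 2!mulr_sumr -big_split/= !big_nat; apply: ler_sum => k.
  rewrite leq0n/= => ks.
  (* Monotonicity of the identity along the partition says that consecutive points are ordered. *)
  have ndid : {in `[a, b] &, nondecreasing_fun (@id R)} by [].
  have uv := nondecreasing_fun_itv_partition ndid abs ks.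
  have inab i : (i <= size s)%N -> a <= nth b (a :: s) i <= b.
    move=> isz; have sas : sorted <=%R (a :: s).
      by case: abs => abs _; apply: sub_path abs => x y /ltW.
    have mono := sorted_leq_nth le_trans le_refl b sas.
    apply/andP; split; first by apply: (mono 0%N) => //; rewrite inE/= ltnS.
    rewrite -[leRHS](itv_partition_nth_size b abs).
    by apply: mono; rewrite ?inE/= ?ltnS.
  have /andP[au _] := inab k (ltnW ks).
  have /andP[_ vb] := inab k.+1 ks.
  apply: le_trans (fg _ _ au uv vb) _; rewrite lerD2l ler_wpM2l//.
  exact: ler_norm.
move=> /le_trans; apply.
have -> : variation a b id s = b - a.
  by apply: nondecreasing_variation => // x y _ _.
rewrite lerD2r.
by rewrite ler_wpM2l//; apply: gM; exact: variations_variation.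
Qed.

End PartsIntegral.

(** * Riemann-Stieltjes sums over uniform meshes *)

Section RiemannSums.
Context {R : realType}.
Local Notation mu := (@lebesgue_measure R).
Implicit Types (f h dh phi : R -> R) (a b t : R) (n k : nat).

Definition mesh_point a b n k : R := a + (b - a) * (k%:R / n.+1%:R).

Lemma mesh_point0 a b n : mesh_point a b n 0 = a.
Proof. by rewrite /mesh_point mul0r mulr0 addr0. Qed.

Lemma mesh_point_last a b n : mesh_point a b n n.+1 = b.
Proof. by rewrite /mesh_point divff ?pnatr_eq0// mulr1 addrC subrK. Qed.

Lemma mesh_pointS a b n k :
  mesh_point a b n k.+1 - mesh_point a b n k = (b - a) / n.+1%:R.
Proof.
rewrite /mesh_point opprD addrACA subrr add0r -mulrBr -mulrBl.
by rewrite -natrB// subSnn mul1r.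
Qed.

Lemma mesh_point_le a b n i j : a <= b -> (i <= j)%N ->
  mesh_point a b n i <= mesh_point a b n j.
Proof.
move=> ab ij; rewrite /mesh_point lerD2l ler_wpM2l ?subr_ge0//.
by rewrite ler_pM2r ?invr_gt0// ler_nat.
Qed.

Lemma mesh_point_itv a b n k : a <= b -> (k <= n.+1)%N ->
  a <= mesh_point a b n k <= b.
Proof.
move=> ab kn; apply/andP; split.
  by rewrite -[leLHS](mesh_point0 a b n); exact: mesh_point_le.
by rewrite -[leRHS](mesh_point_last a b n); exact: mesh_point_le.
Qed.

(** The left-point Riemann-Stieltjes sum of [h] against [f] up to [t]. Cutting the mesh points at
    [t] makes later cells contribute 0 and matches the form of [simple_integral]. *)
Definition mesh_sum a b h f n t : R :=
  \sum_(k < n.+1) h (mesh_point a b n k) *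
    (f (Num.min (mesh_point a b n k.+1) t) - f (Num.min (mesh_point a b n k) t)).

Lemma mesh_telescope a b f n t : a <= t <= b ->
  \sum_(k < n.+1) (f (Num.min (mesh_point a b n k.+1) t) -
                   f (Num.min (mesh_point a b n k) t)) = f t - f a.
Proof.
move=> /andP[at_ tb].
rewrite -(big_mkord xpredT (fun k => f (Num.min (mesh_point a b n k.+1) t) -
                   f (Num.min (mesh_point a b n k) t))).
rewrite (telescope_sumr (fun k => f (Num.min (mesh_point a b n k) t)))//.
by rewrite mesh_point0 mesh_point_last (min_idPr tb) (min_idPl at_).
Qed.

(** On each cell the error is an integral of [dh] times an oscillation of [f], hence small compared
    with the length of the cell; the lengths telescope to [t - a]. The modulus of continuity is
    common to the segment, whence uniformity in [t]. *)
Lemma mesh_sum_cvg a b h dh f : a <= b -> primitive_on a b h dh ->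
  {within `[a, b], continuous f} -> forall e : R, 0 < e ->
  \forall n \near \oo, forall t, a <= t <= b ->
    `|mesh_sum a b h f n t - (parts_int a h dh f t - parts_int a h dh f a)| < e.
Proof.
move=> ab hdh cf e e0.
have [C C0 HC] := segment_bounded hdh.1.
have K0 : 0 < C * (b - a) + 1 by rewrite ltr_wpDl// mulr_ge0// ?subr_ge0// ltW.
(* The summed error is at most [C * (b - a)] times this tolerance; adding 1 to the divisor keeps it
   positive and the final bound strict. *)
have [|d d0 Hd] := segment_uniform_continuous cf (e := e / (C * (b - a) + 1)).
  by rewrite divr_gt0.
near=> n => t /[dup] tab /andP[at_ tb].
rewrite /mesh_sum -(@mesh_telescope a b (parts_int a h dh f) n t tab) -sumrB.
apply: (@le_lt_trans _ _ (\sum_(k < n.+1) (C * (e / (C * (b - a) + 1)) *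
    (Num.min (mesh_point a b n k.+1) t - Num.min (mesh_point a b n k) t)))).
  apply: (le_trans (ler_norm_sum _ _ _)); apply: ler_sum => k _.
  set x := mesh_point a b n k; set y := mesh_point a b n k.+1.
  have /andP[ax xb] : a <= x <= b by rewrite mesh_point_itv// ltnW.
  have /andP[ay yb] : a <= y <= b by rewrite mesh_point_itv.
  have xy : x <= y by exact: mesh_point_le.
  have [tx|xt] := leP t x.
    by rewrite (min_idPr (le_trans tx xy)) !subrr mulr0 subrr normr0 mulr0.
  have av : a <= Num.min y t by rewrite le_min ay.
  have xv : x <= Num.min y t by rewrite le_min xy ltW.
  have vb : Num.min y t <= b by rewrite ge_min yb.
  rewrite (parts_int_increment hdh cf ax xv vb) opprD addrA subrr add0r normrN.
  apply: ler_Rintegral_segment => //.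
    apply: (integrable_subsegment ax vb); apply: segment_integrable.
    apply: within_continuousM hdh.1 _; apply: within_continuousB => //.
    by apply: continuous_subspaceT => ?; exact: cvg_cst.
  move=> s /andP[xs sv]; rewrite normrM; apply: ler_pM => //.
    by apply: HC; rewrite (le_trans ax xs) (le_trans sv vb).
  apply/ltW/Hd; rewrite ?av ?vb ?(le_trans ax xs) ?(le_trans sv vb)//.
  rewrite ger0_norm ?subr_ge0//; apply: (@le_lt_trans _ _ (y - x)).
    by apply: lerB => //; rewrite ge_min lexx.
  rewrite mesh_pointS ltr_pdivrMr// mulrC -ltr_pdivrMr//.
  have : (b - a) / d < n%:R by near: n; exact: nbhs_infty_gtr.
  by move=> /lt_le_trans; apply; rewrite ler_nat.
rewrite -mulr_sumr (mesh_telescope id)//=.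
rewrite [_ < _](_ : _ = (C * (t - a) * e / (C * (b - a) + 1) < e)); last first.
  by congr (_ < _); ring.
rewrite ltr_pdivrMr// mulrC ltr_pM2l// ltr_pwDr// ler_wpM2l ?(ltW C0)//.
by rewrite lerD2r.
Unshelve. all: by end_near. Qed.

Lemma abel_summation (c d : nat -> R) N :
  \sum_(k < N) c k * (d k.+1 - d k) =
  c N * d N - c 0%N * d 0%N - \sum_(k < N) (c k.+1 - c k) * d k.+1.
Proof.
elim: N => [|N IH]; first by rewrite !big_ord0 subr0 subrr.
by rewrite !big_ord_recr/= IH; ring.
Qed.

(* Summation by parts makes the constant independent of the mesh n. *)
Lemma mesh_sum_bounded a b h dh : a <= b -> primitive_on a b h dh ->
  exists2 C : R, 0 < C & forall f (M : R) n t, a <= t <= b ->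
    (forall s, a <= s <= t -> `|f s| <= M) -> `|mesh_sum a b h f n t| <= C * M.
Proof.
move=> ab hdh.
have [B B0 HB] := segment_bounded (primitive_continuous hdh).
have [L L0 HL] := primitive_lipschitz hdh.
(* Each boundary term of Abel summation costs [B]; the [n.+1] increments of [h], each at most
   [L * (b - a) / n.+1], together cost the last summand. *)
exists (B + B + L * (b - a)).
  by rewrite ltr_wpDr ?addr_gt0// mulr_ge0// ?subr_ge0// ltW.
move=> f M n t /andP[at_ tb] fM.
have fM' k : (k <= n.+1)%N -> `|f (Num.min (mesh_point a b n k) t)| <= M.
  move=> kn; apply: fM; have /andP[ak _] := mesh_point_itv ab kn.
  by rewrite le_min ak at_ ge_min lexx orbT.
have M0 : 0 <= M by exact: le_trans (fM' 0%N _).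
rewrite /mesh_sum (abel_summation (fun k => h (mesh_point a b n k))
  (fun k => f (Num.min (mesh_point a b n k) t))).
rewrite mulrDl mulrDl; apply: (le_trans (ler_normB _ _)); apply: lerD.
  by apply: (le_trans (ler_normB _ _)); apply: lerD; rewrite normrM ler_pM//;
    rewrite ?HB ?fM'// mesh_point_itv.
apply: (le_trans (ler_norm_sum _ _ _)).
apply: (@le_trans _ _ (\sum_(k < n.+1) (L * ((b - a) / n.+1%:R) * M))).
  apply: ler_sum => k _; rewrite normrM ler_pM// ?fM'//.
  rewrite -(mesh_pointS a b n k); have /andP[ak _] := mesh_point_itv ab (ltnW (ltn_ord k)).
  have /andP[_ kb] := mesh_point_itv ab (ltn_ord k).
  by apply: HL => //; exact: mesh_point_le.
rewrite sumr_const card_ord -(mulr_natl (L * _ * M)).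
have N0 : n.+1%:R != 0 :> R by rewrite pnatr_eq0.
have E (N : R) : N != 0 -> N * (L * ((b - a) / N) * M) = L * (b - a) * M.
  by move=> ?; field.
by rewrite E.
Qed.

(* Summing over finer and finer meshes; this replaces the Lebesgue
   differentiation theorem in the integration by parts below, where the density
   phi is merely integrable. *)
Lemma eq_endpoints_of_superlinear_increments a b f g : a <= b ->
  (forall u v, a <= u -> u <= v -> v <= b -> `|f v - f u| <= (v - u) * (g v - g u)) ->
  f b = f a.
Proof.
move=> ab fg; apply/eqP; rewrite -subr_eq0 -normr_le0; apply/ler_addgt0Pr => e e0.
(* On a uniform mesh the factor [v - u] is the same for all cells, and the increments of [g]
   telescope. *)
have H n : `|f b - f a| <= (b - a) / n.+1%:R * (g b - g a).
  have bab : a <= b <= b by rewrite ab lexx.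
  rewrite -(mesh_telescope f n bab) -(mesh_telescope g n bab) mulr_sumr.
  apply: (le_trans (ler_norm_sum _ _ _)); apply: ler_sum => k _.
  rewrite -(mesh_pointS a b n k).
  have /andP[ak kb] := mesh_point_itv ab (ltnW (ltn_ord k)).
  have /andP[ak1 k1b] := mesh_point_itv ab (ltn_ord k).
  rewrite (min_idPl k1b) (min_idPl kb).
  by apply: fg => //; exact: mesh_point_le.
have := archi_boundP (normr_ge0 ((b - a) * (g b - g a) / e)).
set n := Num.bound _ => nP.
rewrite add0r; apply: (le_trans (H n)).
rewrite mulrAC ler_pdivrMr// [e * _]mulrC -ler_pdivrMr//.
apply: (le_trans (ler_norm _)); apply: (le_trans (ltW nP)).
by rewrite ler_nat.
Qed.

(** As a function of the upper limit, the difference [G] of the two sides has increments bounded by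
    a length times an increment of the integral [V] of [|phi|], so it is constant. *)
Lemma parts_int_indefinite a b h dh f phi : a <= b -> primitive_on a b h dh ->
  mu.-integrable `[a, b] (EFin \o phi) ->
  (forall t, a <= t <= b -> f t = f a + \int[mu]_(s in `[a, t]) phi s) ->
  \int[mu]_(s in `[a, b]) (h s * phi s) =
  parts_int a h dh f b - parts_int a h dh f a.
Proof.
move=> ab hdh iphi fE.
have df u v : a <= u -> u <= v -> v <= b ->
    f v - f u = \int[mu]_(s in `[u, v]) phi s.
  move=> au uv vb; rewrite (fE u) ?(fE v) ?au ?vb ?(le_trans au uv) ?(le_trans uv vb)//.
  rewrite (@Rintegral_cat _ a u v)//; first by ring.
  exact: integrable_subsegment iphi.
have cf : {within `[a, b], continuous f}.
  have := parameterized_integral_continuous ab iphi.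
  move=> /within_continuousP c; apply/within_continuousP => x ax e e0.
  have [d d0 Hd] := c x ax e e0; exists d => // y ay xy.
  by rewrite (fE x)// (fE y)// opprD addrACA subrr add0r; exact: Hd.
have ihphi := segment_integrableM (primitive_continuous hdh) iphi.
have iabs : mu.-integrable `[a, b] (EFin \o (fun s => `|phi s|)).
  exact: (integrable_norm iphi).
have [B B0 HB] := segment_bounded hdh.1.
have [L L0 HL] := primitive_lipschitz hdh.
pose V t := \int[mu]_(s in `[a, t]) `|phi s|.
have dV u v : a <= u -> u <= v -> v <= b -> V v - V u = \int[mu]_(s in `[u, v]) `|phi s|.
  move=> au uv vb; rewrite /V (@Rintegral_cat _ a u v)//; first by ring.
  exact: integrable_subsegment iabs.
pose G t := parts_int a h dh f t - \int[mu]_(s in `[a, t]) (h s * phi s).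
suff : G b = G a.
  rewrite /G set_itv1 Rintegral_set1 subr0 => <-.
  by rewrite opprB addrCA subrr addr0.
apply: (@eq_endpoints_of_superlinear_increments a b G (fun t => (B + L) * V t)) => //.
move=> u v au uv vb.
have iphiuv := integrable_subsegment au vb iphi.
have iabsuv := integrable_subsegment au vb iabs.
(* With [h] frozen at [u] the main terms cancel. Both remainders carry a factor [v - u]: the first
   from the length of the segment, the second from the Lipschitz bound on [h]; the other factor is
   an increment of [V] in each. *)
have -> : G v - G u = \int[mu]_(s in `[u, v]) (dh s * (f v - f s)) -
    \int[mu]_(s in `[u, v]) ((h s - h u) * phi s).
  rewrite /G (@Rintegral_cat _ a u v)//; last exact: integrable_subsegment ihphi.
  have := parts_int_increment hdh cf au uv vb.
  rewrite df// -(RintegralZl (h u))// => E.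
  have -> : \int[mu]_(s in `[u, v]) ((h s - h u) * phi s) =
      \int[mu]_(s in `[u, v]) (h s * phi s) - \int[mu]_(s in `[u, v]) (h u * phi s).
    rewrite -RintegralB//.
    - by apply: eq_Rintegral => s _; rewrite mulrBl.
    - exact: integrable_subsegment ihphi.
    - apply: (segment_integrableM (f := fun=> h u)) => //.
      by apply: continuous_subspaceT => ?; exact: cvg_cst.
  by move: E; lra.
apply: (le_trans (ler_normB _ _)); rewrite -mulrBr dV// mulrCA mulrDl; apply: lerD.
  rewrite [(v - u) * _]mulrC mulrA; apply: ler_Rintegral_segment => //.
    apply: (integrable_subsegment au vb); apply: segment_integrable.
    apply: within_continuousM hdh.1 _; apply: within_continuousB => //.
    by apply: continuous_subspaceT => ?; exact: cvg_cst.
  move=> s /andP[us sv]; have as_ := le_trans au us; have sb := le_trans sv vb.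
  rewrite normrM ler_pM// ?HB ?as_//.
  rewrite df//; apply: (le_trans (le_normr_Rintegral _ _)) => //.
    exact: integrable_subsegment iphi.
  rewrite -[leLHS]add0r (@Rintegral_cat _ u s v)// lerD2r.
  by apply: Rintegral_ge0.
have ihu : mu.-integrable `[u, v] (EFin \o (fun s => (h s - h u) * phi s)).
  apply: segment_integrableM => //; apply: within_continuousB => //.
    by apply: continuous_subspaceW (primitive_continuous hdh); exact: sub_segment.
  by apply: continuous_subspaceT => ?; exact: cvg_cst.
apply: (le_trans (le_normr_Rintegral _ ihu)) => //.
rewrite mulrA -(RintegralZl (_ * _))//; apply: le_Rintegral => //.
- exact: (integrable_norm ihu).
- apply: (segment_integrableM (f := fun=> L * (v - u))) => //.
  by apply: continuous_subspaceT => ?; exact: cvg_cst.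
move=> s; rewrite /= in_itv/= => /andP[us sv].
rewrite normrM ler_wpM2r//; apply: (le_trans (HL _ _ au us (le_trans sv vb))).
by rewrite ler_wpM2l ?(ltW L0)// lerD2r.
Qed.

End RiemannSums.

(** * Joint measurability of processes and measurability of time integrals *)

Section JointMeasurability.
Context {R : realType}.
Local Notation mu := (@lebesgue_measure R).
Implicit Types (a b t : R).

(** The nearest-point retraction onto [[a, b]]: composing with it extends a function controlled only
    on the segment to the whole line without losing continuity. *)
Definition clamp a b t : R := Num.max a (Num.min t b).

Lemma clamp_itv a b t : a <= b -> a <= clamp a b t <= b.
Proof. by move=> ab; rewrite /clamp le_max lexx/= ge_max ab ge_min lexx orbT. Qed.

Lemma clampE a b t : a <= t <= b -> clamp a b t = t.
Proof. by move=> /andP[at_ tb]; rewrite /clamp (min_idPl tb) (max_idPr at_). Qed.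

Lemma clamp_lipschitz a b s t : `|clamp a b s - clamp a b t| <= `|s - t|.
Proof.
have := ler_norm (s - t); have := ler_norm (t - s); rewrite (distrC t s) ler_norml.
rewrite /clamp; case: (leP s b); case: (leP t b);
case: (leP a s); case: (leP a t); case: (leP a b); lra.
Qed.

Lemma continuous_clamp a b (f : R -> R) : a <= b ->
  {within `[a, b], continuous f} -> continuous (f \o clamp a b).
Proof.
move=> ab /within_continuousP cf x; apply/cvgrPdist_lt => e e0.
have [|d d0 H] := cf (clamp a b x) _ e e0; first by rewrite /= in_itv/= clamp_itv.
exists d => //= y xy; apply: H; first by rewrite /= in_itv/= clamp_itv.
exact: le_lt_trans (clamp_lipschitz _ _ _ _) xy.
Qed.

Lemma measurable_clamp a b : a <= b -> measurable_fun setT (clamp a b).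
Proof.
move=> ab; apply: continuous_measurable_fun.
apply: (continuous_clamp (f := id)) => //.
by apply: continuous_subspaceT => ?; exact: cvg_id.
Qed.

(** The classical fact about Caratheodory functions: sampling time on a grid gives jointly
    measurable approximations, and continuity in time makes them converge pointwise. *)
Lemma measurable_fun_continuous_sections d (T : measurableType d) a b
    (f : R -> T -> R) : a <= b ->
  (forall s, a <= s <= b -> measurable_fun setT (f s)) ->
  (forall w, {within `[a, b], continuous (fun s => f s w)}) ->
  measurable_fun setT (fun p : R * T => f (clamp a b p.1) p.2).
Proof.
move=> ab mf cf.
(* The sections are sampled at a point of the grid a + nat / n.+1, so that the
   approximations take countably many sections as values. *)
pose idx n (p : R * T) := Num.truncn ((clamp a b p.1 - a) * n.+1%:R).
have idx0 n (p : R * T) : 0 <= (clamp a b p.1 - a) * n.+1%:R.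
  by rewrite mulr_ge0// subr_ge0; have /andP[] := clamp_itv p.1 ab.
pose fn n (p : R * T) := f (clamp a b (a + (idx n p)%:R / n.+1%:R)) p.2.
apply: (measurable_fun_cvg (h := fn)) => [n|[s w] _].
  move=> _ Y mY; rewrite setTI.
  rewrite (_ : fn n @^-1` Y = \bigcup_k ([set p | idx n p = k] `&`
      (fun p : R * T => f (clamp a b (a + k%:R / n.+1%:R)) p.2) @^-1` Y)); last first.
    apply/seteqP; split => [p /= Yp|p [k _ [/= <-]]//].
    by exists (idx n p).
  apply: bigcupT_measurable => k; apply: measurableI; last first.
    rewrite -[X in measurable X]setTI.
    apply: (measurableT_comp (mf _ _) measurable_snd) => //.
    exact: clamp_itv.
  rewrite (_ : [set p | idx n p = k] =
    (fun p : R * T => (clamp a b p.1 - a) * n.+1%:R) @^-1` `[k%:R, k.+1%:R[); last first.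
    apply/seteqP; split => p /=; rewrite in_itv/=.
      by move=> <-; exact: truncn_itv.
    exact: truncn_def.
  rewrite -[X in measurable X]setTI.
  have m : measurable_fun [set: R * T] (fun p => (clamp a b p.1 - a) * n.+1%:R).
    apply: measurable_funM; last exact: measurable_cst.
    apply: measurable_funB; last exact: measurable_cst.
    exact: (measurableT_comp (measurable_clamp ab) measurable_fst).
  by apply: m => //; exact: measurable_itv.
have csab := clamp_itv s ab.
have := cf w; move=> /within_continuousP /(_ (clamp a b s)).
rewrite /= in_itv/= => /(_ csab) H.
apply/cvgrPdist_lt => e e0; have [r r0 Hr] := H _ e0.
near=> n; apply: Hr; first by rewrite in_itv/= clamp_itv.
rewrite -{1}(clampE csab); apply: (le_lt_trans (clamp_lipschitz _ _ _ _)).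
have /andP[h1 h2] := truncn_itv (idx0 n (s, w)).
rewrite opprD addrA ger0_norm; last by rewrite subr_ge0 ler_pdivrMr.
apply: (@le_lt_trans _ _ (n.+1%:R^-1)).
  rewrite lerBlDr [leRHS](_ : _ = (idx n (s, w)).+1%:R / n.+1%:R).
    by rewrite ler_pdivlMr// ltW.
  by rewrite -(natr1 (idx _ _)) mulrDl mul1r addrC.
rewrite -[ltRHS]invrK ltf_pV2 ?posrE ?invr_gt0//.
have : r^-1 < n%:R by near: n; exact: nbhs_infty_gtr.
by move=> /lt_le_trans; apply; rewrite ler_nat.
Unshelve. all: by end_near. Qed.

(** Tonelli applies to the positive and negative parts separately; sections with an infinite
    integral are sent to 0 by [fine], which is measurable. *)
Lemma measurable_Rintegral_parameter d (T : measurableType d) (D : set R)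
    (f : R * T -> R) : measurable D -> measurable_fun setT f ->
  measurable_fun setT (fun w => \int[mu]_(s in D) f (s, w)).
Proof.
move=> mD mf.
pose F (p : R * T) := ((f p * \1_D p.1)%:E).
have mF : measurable_fun setT F.
  apply/measurable_EFinP; apply: measurable_funM => //.
  by apply: (measurableT_comp _ measurable_fst); exact: measurable_indic.
have -> : (fun w => \int[mu]_(s in D) f (s, w)) =
    fine \o (fun w => \int[mu]_s F^\+ (s, w) - \int[mu]_s F^\- (s, w))%E.
  apply/funext => w /=; rewrite /Rintegral; congr fine.
  rewrite integral_mkcond (_ : _ \_ D = (fun s => F (s, w))); last first.
    by apply/funext => s; rewrite /F /patch indicE;
       case: ifPn => sD; rewrite /= ?mulr1 ?mulr0.
  rewrite integralE; under eq_integral do rewrite funepos_comp/=.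
  by under [X in (_ - X)%E = _]eq_integral do rewrite funeneg_comp/=.
apply: measurableT_comp; first exact: fine_measurable.
apply: emeasurable_funB.
  by apply: (@measurable_fun_fubini_tonelli_G _ _ _ _ _ mu) => //; exact: measurable_funepos.
by apply: (@measurable_fun_fubini_tonelli_G _ _ _ _ _ mu) => //; exact: measurable_funeneg.
Qed.

End JointMeasurability.

(** * Complete filtrations and adaptedness of pathwise transforms *)

Section Adaptedness.
Context {R : realType} {d : measure_display} {Omega : measurableType d}.
Variables (P : probability Omega R) (G : R -> set (set Omega)).
Hypothesis hG : usual_filtration P G.
Local Notation mu := (@lebesgue_measure R).
Implicit Types (a b t : R) (L : R -> Omega -> R) (f : Omega -> R) (N : set Omega).

Lemma filtration_sigma_algebra t : 0 <= t -> sigma_algebra setT (G t).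
Proof. by case: hG => H _ _ _ /H[]. Qed.

Lemma filtration_measurable t : 0 <= t -> G t `<=` measurable.
Proof. by case: hG => H _ _ _ /H[]. Qed.

Lemma filtration_le s t : 0 <= s -> s <= t -> G s `<=` G t.
Proof. by case: hG => _ H _ _; exact: H. Qed.

Lemma filtration_negligible t N : 0 <= t -> P.-negligible N -> G t N.
Proof. by case: hG => _ H _ G0 t0 /G0; apply: H. Qed.

(** Gives access to the closure properties of measurable functions over a sub-sigma-algebra;
    generating from [S] adds no sets. *)
Lemma measurable_wrtP (S : set (set Omega)) f : sigma_algebra setT S ->
  measurable_wrt S f <-> measurable_fun [set: g_sigma_algebraType S] f.
Proof.
move=> sS; split => mf.
  by move=> _ B mB; rewrite setTI; apply: sub_sigma_algebra; exact: mf.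
move=> B mB; have := mf measurableT B mB; rewrite setTI.
suff : <<s S >> (f @^-1` B) -> S (f @^-1` B) by [].
by rewrite sigma_algebra_id.
Qed.

Lemma measurable_wrt_measurable t f : 0 <= t -> measurable_wrt (G t) f ->
  measurable_fun setT f.
Proof.
by move=> t0 mf _ B mB; rewrite setTI; apply: (filtration_measurable t0); exact: mf.
Qed.

Lemma aeE (Q : Omega -> Prop) : {ae P, forall w, Q w} ->
  exists N, [/\ measurable N, P N = 0 & forall w, ~ N w -> Q w].
Proof.
move=> [N [mN PN NQ]]; exists N; split => // w Nw.
by apply: contrapT => Qw; apply: Nw; exact: NQ.
Qed.

(** The two preimages differ only inside a null set, all of whose subsets belong to [G t] by
    completeness. *)
Lemma measurable_wrt_ae_eq t f f' : 0 <= t -> measurable_wrt (G t) f ->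
  {ae P, forall w, f w = f' w} -> measurable_wrt (G t) f'.
Proof.
move=> t0 mf /aeE[N [mN PN ff']].
have nN : P.-negligible N by apply/negligibleP.
have sG := filtration_sigma_algebra t0.
apply/measurable_wrtP => //; have /measurable_wrtP - /(_ sG) mf' := mf.
move=> _ B mB; rewrite setTI.
rewrite (_ : f' @^-1` B = (f @^-1` B `&` ~` N) `|` (f' @^-1` B `&` N)).
  apply: measurableU; apply: sub_sigma_algebra.
    suff : <<s G t >> (f @^-1` B `&` ~` N) by rewrite sigma_algebra_id.
    apply: (@measurableI _ (g_sigma_algebraType (G t))).
      by apply: sub_sigma_algebra; exact: mf.
    by apply: measurableC; apply: sub_sigma_algebra; exact: filtration_negligible.
  by apply: filtration_negligible => //; apply: negligibleS nN; exact: subIsetr.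
apply/seteqP; split => w /=.
  by have [Nw|Nw] := pselect (N w); [right|left; rewrite ff'].
by move=> [[fw Nw]|[]//]; rewrite -ff'.
Qed.

Lemma measurable_wrt_le s t f : 0 <= s -> s <= t -> measurable_wrt (G s) f ->
  measurable_wrt (G t) f.
Proof. by move=> s0 st mf B mB; apply: (filtration_le s0 st); exact: mf. Qed.

(* Setting L to 0 on the null event where its paths are bad makes all the paths
   continuous; completeness of the filtration keeps the process adapted. *)
Definition vanish_on N L : R -> Omega -> R := fun t w => if w \in N then 0 else L t w.

Lemma measurable_wrt_vanish_on t s N L : 0 <= t -> measurable N -> P N = 0 ->
  measurable_wrt (G t) (L s) -> measurable_wrt (G t) (vanish_on N L s).
Proof.
move=> t0 mN PN mL; apply: (measurable_wrt_ae_eq t0 mL).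
exists N; split => // w /= H; apply: contrapT => Nw; apply: H.
by rewrite /vanish_on; case: ifPn => //; rewrite inE.
Qed.

Lemma continuous_vanish_on N L (D : set R) :
  (forall w, ~ N w -> {within D, continuous (fun t => L t w)}) ->
  forall w, {within D, continuous (fun t => vanish_on N L t w)}.
Proof.
move=> cL w; have [wN|wN] := boolP (w \in N).
  rewrite (_ : (fun t => _) = fun=> 0).
    by apply: continuous_subspaceT => ?; exact: cvg_cst.
  by apply/funext => t; rewrite /vanish_on wN.
rewrite (_ : (fun t => _) = fun t => L t w).
  by apply: cL => Nw; move/negP : wN; apply; rewrite inE.
by apply/funext => t; rewrite /vanish_on (negbTE wN).
Qed.

(** The joint measurability argument is run on [Omega] equipped with [G t]: up to time [t] all the
    sections are measurable for it. *)
Lemma measurable_wrt_Rintegral a t (k : R -> R) L : 0 <= a -> a <= t ->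
  {within `[a, t], continuous k} ->
  (forall s, a <= s <= t -> measurable_wrt (G t) (L s)) ->
  (forall w, {within `[a, t], continuous (fun s => L s w)}) ->
  measurable_wrt (G t) (fun w => \int[mu]_(s in `[a, t]) (k s * L s w)).
Proof.
move=> a0 at_ ck mL cL; have t0 := le_trans a0 at_.
have sG := filtration_sigma_algebra t0.
apply/measurable_wrtP => //.
pose T' := g_sigma_algebraType (G t).
have -> : (fun w => \int[mu]_(s in `[a, t]) (k s * L s w)) =
    (fun w : T' => \int[mu]_(s in `[a, t])
       (k (clamp a t s) * L (clamp a t s) w)).
  apply/funext => w; apply: eq_Rintegral => s; rewrite inE/= in_itv/= => ast.
  by rewrite clampE.
apply: (@measurable_Rintegral_parameter _ _ T' `[a, t]
  (fun p => k (clamp a t p.1) * L (clamp a t p.1) p.2)) => //.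
apply: measurable_funM.
  have mk : measurable_fun setT (k \o clamp a t).
    by apply: continuous_measurable_fun; exact: continuous_clamp.
  exact: (measurableT_comp mk measurable_fst).
apply: (measurable_fun_continuous_sections (T := T') (f := L)) => // s ast.
by apply/measurable_wrtP => //; exact: mL.
Qed.

Lemma adapted_parts_int a T (h dh : R -> R) L : 0 <= a ->
  (forall b, a <= b < T -> primitive_on a b h dh) ->
  adapted_on G `[a, T[ L -> continuous_paths_on P `[a, T[ L ->
  adapted_on G `[a, T[ (fun t w => parts_int a h dh (fun s => L s w) t).
Proof.
move=> a0 hdh aL cL t /=; rewrite in_itv/= => /andP[at_ tT].
have t0 := le_trans a0 at_; have sG := filtration_sigma_algebra t0.
have [N [mN PN cLN]] := aeE cL.
have Hc : {within `[a, t], continuous dh} by apply: (hdh t _).1; rewrite at_.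
have mint : measurable_wrt (G t)
    (fun w => \int[mu]_(s in `[a, t]) (dh s * vanish_on N L s w)).
  apply: measurable_wrt_Rintegral => //.
    move=> s /andP[as_ st]; apply: measurable_wrt_vanish_on => //.
    apply: (measurable_wrt_le _ st); first exact: le_trans as_.
    by apply: aL; rewrite /= in_itv/= as_ (le_lt_trans st).
  apply: continuous_vanish_on => w /cLN; apply: continuous_subspaceW => s /=.
  by rewrite !in_itv/= => /andP[-> st]; rewrite (le_lt_trans st).
apply: (@measurable_wrt_ae_eq t (fun w => h t * L t w -
    \int[mu]_(s in `[a, t]) (dh s * vanish_on N L s w))) => //.
  apply/measurable_wrtP => //; apply: measurable_funB.
    apply: measurable_funM => //; apply/measurable_wrtP => //; apply: aL.
    by rewrite /= in_itv/= at_.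
  exact/measurable_wrtP.
exists N; split => // w /= H; apply: contrapT => Nw; apply: H.
rewrite /parts_int; congr (_ - _); apply: eq_Rintegral => s _.
by rewrite /vanish_on; case: ifPn => //; rewrite inE.
Qed.

End Adaptedness.

(** * Fubini for integrands bounded in L^1 uniformly in time *)

Section BoundedFubini.
Context {R : realType} {d : measure_display} {Omega : measurableType d}.
Variable P : probability Omega R.
Local Notation mu := (@lebesgue_measure R).
Variables (D : set R) (f : R * Omega -> R) (B : R).
Hypotheses (mD : measurable D) (Dfin : (mu D < +oo)%E) (B0 : 0 <= B).
Hypothesis mf : measurable_fun setT f.
Hypothesis fB : forall u, D u -> (\int[P]_w `|f (u, w)|%:E <= B%:E)%E.
Hypothesis fi : forall w, mu.-integrable D (fun u => (f (u, w))%:E).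

(** The indicators move the restrictions to [D] and [A] into the integrand, so that Fubini is
    applied on the full product space. *)
Let phi (A : set Omega) (p : R * Omega) : \bar R := (f p * \1_D p.1 * \1_A p.2)%:E.

Let measurable_phi A : measurable A -> measurable_fun setT (phi A).
Proof.
move=> mA; apply/measurable_EFinP.
have m1 : measurable_fun setT (\1_D : R -> R) by exact: measurable_indic.
have m2 : measurable_fun setT (\1_A : Omega -> R) by exact: measurable_indic.
apply: measurable_funM; first apply: measurable_funM => //.
  exact: (measurableT_comp m1 measurable_fst).
exact: (measurableT_comp m2 measurable_snd).
Qed.

Let integrable_phi A : measurable A -> (mu \x P)%E.-integrable setT (phi A).
Proof.
move=> mA; have mphi := measurable_phi mA.
apply/(integrable12ltyP mu P mphi).
apply: (@le_lt_trans _ _ (\int[mu]_(x in D) B%:E)%E); last first.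
  by rewrite integral_cst// lte_mul_pinfty.
rewrite [leRHS]integral_mkcond; apply: ge0_le_integral => //.
- by move=> u _; exact: integral_ge0.
- apply: (measurable_fun_fubini_tonelli_F (abse \o phi A)).
    exact: measurableT_comp.
  by move=> p; exact: abse_ge0.
- exact/(measurable_restrictT _ mD)/measurable_cst.
move=> u _; rewrite /patch; case: ifPn => uD; last first.
  by rewrite integral0_eq// => w _; rewrite /phi indicE (negbTE uD) mulr0 mul0r abse0.
move: uD; rewrite inE => uD; apply: le_trans (fB uD).
apply: ge0_le_integral => //.
- apply/measurable_EFinP; apply: measurableT_comp => //; apply/measurable_EFinP.
  exact: (measurableT_comp mphi (measurable_pair1 u)).
- apply/measurable_EFinP; apply: measurableT_comp => //.
  exact: (measurableT_comp mf (measurable_pair1 u)).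
move=> w _; rewrite /phi lee_fin !normrM -mulrA ler_piMr//.
by rewrite !indicE; case: (_ \in _); case: (_ \in _);
  rewrite /= ?normr1 ?normr0 ?mulr1 ?mulr0 ?mul0r.
Qed.

Let phiG A w : measurable A ->
  (\int[mu]_u phi A (u, w) = ((\int[mu]_(u in D) f (u, w)) * \1_A w)%:E)%E.
Proof.
move=> mA; rewrite EFinM /Rintegral fineK; last exact: integrable_fin_num.
rewrite integral_mkcond -integralZr//; last first.
  by rewrite -integrable_mkcond.
apply: eq_integral => u _; rewrite /phi /patch indicE/=.
by case: ifPn => _; rewrite ?mulr1 ?mulr0 ?mul0r ?mul0e.
Qed.

Let f_integrable u : D u -> P.-integrable setT (fun w => (f (u, w))%:E).
Proof.
move=> uD; apply/integrableP; split.
  by apply/measurable_EFinP; exact: (measurableT_comp mf (measurable_pair1 u)).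
by apply: le_lt_trans (fB uD) _; rewrite ltry.
Qed.

Let phiF A u : measurable A ->
  (\int[P]_w phi A (u, w) = ((\int[P]_(w in A) f (u, w)) * \1_D u)%:E)%E.
Proof.
move=> mA; rewrite indicE; have [uD|uD] := boolP (u \in D); last first.
  by rewrite mulr0 integral0_eq// => w _; rewrite /phi indicE (negbTE uD) mulr0 mul0r.
rewrite mulr1 /Rintegral fineK; last first.
  apply: integrable_fin_num => //; apply: integrableS (f_integrable _) => //.
  by move: uD; rewrite inE.
rewrite [RHS]integral_mkcond; apply: eq_integral => w _.
by rewrite /phi /patch !indicE/= uD; case: ifPn => _; rewrite ?mulr1 ?mulr0.
Qed.

Lemma integrable_Rintegral_section :
  P.-integrable setT (fun w => (\int[mu]_(u in D) f (u, w))%:E).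
Proof.
have iphi := integrable_phi measurableT.
have mphi := measurable_phi measurableT.
apply/integrableP; split.
  by apply/measurable_EFinP; exact: (measurable_Rintegral_parameter mD mf).
apply: le_lt_trans ((integrable21ltyP mu P mphi).1 iphi).
apply: ge0_le_integral => //.
- apply: measurableT_comp => //; apply/measurable_EFinP.
  exact: (measurable_Rintegral_parameter mD mf).
- apply: (@measurable_fun_fubini_tonelli_G _ _ (measurableTypeR R) _ _ mu
    (abse \o phi setT)).
    exact: measurableT_comp.
  by move=> p; exact: abse_ge0.
move=> w _; have := phiG w measurableT; rewrite indicT mulr1 => <-.
apply: le_abse_integral => //.
exact: (measurableT_comp mphi (measurable_pair2 w)).
Qed.

Lemma Rintegral_exchange A : measurable A ->
  \int[P]_(w in A) \int[mu]_(u in D) f (u, w) =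
  \int[mu]_(u in D) \int[P]_(w in A) f (u, w).
Proof.
move=> mA; have := Fubini (integrable_phi mA).
under eq_integral do rewrite phiF//.
under [in RHS]eq_integral do rewrite phiG//.
move=> E; rewrite [LHS]/Rintegral [RHS]/Rintegral; congr fine.
rewrite integral_mkcond [RHS]integral_mkcond.
transitivity (\int[P]_x ((\int[mu]_(u in D) f (u, x) * \1_A x)%:E))%E.
  apply: eq_integral => w _; rewrite /patch indicE.
  by case: ifPn => _; rewrite ?mulr1 ?mulr0.
rewrite -E; apply: eq_integral => u _; rewrite /patch indicE.
by case: ifPn => _; rewrite ?mulr1 ?mulr0.
Qed.

End BoundedFubini.

(** * The transform of a martingale is a martingale *)

Section MartingaleTransform.
Context {R : realType} {d : measure_display} {Omega : measurableType d}.
Variables (P : probability Omega R) (G : R -> set (set Omega)).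
Hypothesis hG : usual_filtration P G.
Local Notation mu := (@lebesgue_measure R).
Implicit Types (a b s t T : R) (L : R -> Omega -> R) (A : set Omega) (h dh : R -> R).

Lemma EFin_Rintegral A (f : Omega -> R) : measurable A ->
  P.-integrable A (EFin \o f) ->
  (\int[P]_(w in A) (f w)%:E)%E = (\int[P]_(w in A) f w)%:E.
Proof. by move=> mA fi; rewrite /Rintegral fineK//; exact: integrable_fin_num. Qed.

Lemma martingale_Rintegral a T L s t A : 0 <= a -> martingale_on P G a T L ->
  a <= s -> s <= t -> t < T -> G s A ->
  \int[P]_(w in A) L t w = \int[P]_(w in A) L s w.
Proof. by move=> a0 [_ _ mL] as_ st tT sA; congr fine; exact: mL. Qed.

(** The sign of [L s] splits [Omega] into two events of [G s]; on each, the integral of [|L s|] is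
    plus or minus that of [L t], by the martingale property. This yields the uniform L^1 bound that
    Fubini needs. *)
Lemma martingale_L1_le a T L s t : 0 <= a -> martingale_on P G a T L ->
  a <= s -> s <= t -> t < T ->
  \int[P]_w `|L s w| <= \int[P]_w `|L t w|.
Proof.
move=> a0 mL as_ st tT; have [aL iL _] := mL.
have s0 := le_trans a0 as_.
have is_ : P.-integrable setT (EFin \o L s) by apply: iL; rewrite as_ (le_lt_trans st).
have it : P.-integrable setT (EFin \o L t) by apply: iL; rewrite (le_trans as_ st).
pose A := L s @^-1` `[0, +oo[.
have As : measurable_wrt (G s) (L s).
  by apply: aL; rewrite /= in_itv/= as_ (le_lt_trans st).
have GA : G s A by apply: As.
have GA' : G s (~` A) by rewrite /A preimage_setC; apply: As; exact: measurableC.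
have mA : measurable A by exact: (filtration_measurable hG s0).
have mA' : measurable (~` A) by exact: measurableC.
have split f : P.-integrable setT (EFin \o f) ->
    \int[P]_w f w = \int[P]_(w in A) f w + \int[P]_(w in ~` A) f w.
  move=> fi; rewrite -(setUv A) Rintegral_setU ?setUv//.
  by apply/disj_setPS => w [].
have sub f D : measurable D -> P.-integrable setT (EFin \o f) ->
    P.-integrable D (EFin \o f) by move=> mD fi; apply: integrableS fi.
rewrite split; last exact: integrable_norm.
rewrite (split (fun w => `|L t w|)); last exact: integrable_norm.
apply: lerD.
  rewrite (@eq_Rintegral _ _ _ _ A (L s)); last first.
    by move=> w; rewrite inE /A/= in_itv/= andbT => /ger0_norm.
  rewrite -(martingale_Rintegral a0 mL as_ st tT GA).
  apply: le_Rintegral => //; [exact: sub|apply: sub => //; exact: integrable_norm|].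
  by move=> w _; exact: ler_norm.
rewrite (@eq_Rintegral _ _ _ _ (~` A) (fun w => -1 * L s w)); last first.
  move=> w; rewrite inE /A/= in_itv/= andbT => /negP; rewrite -ltNge => /ltr0_norm ->.
  by rewrite mulN1r.
rewrite RintegralZl//; last exact: sub.
rewrite -(martingale_Rintegral a0 mL as_ st tT GA') mulN1r.
apply: le_trans (le_normr_Rintegral mA' (sub _ _ mA' it)).
by rewrite -normrN; exact: ler_norm.
Qed.

(** The martingale property involves only fixed times, so the exceptional null set may depend on
    [t]. *)
Lemma martingale_on_ae_eq a T L L' : 0 <= a -> martingale_on P G a T L ->
  (forall t, a <= t < T -> {ae P, forall w, L t w = L' t w}) ->
  martingale_on P G a T L'.
Proof.
move=> a0 [aL iL mL] LL'.
have aL' : adapted_on G `[a, T[ L'.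
  move=> t /= tI; have := tI; rewrite in_itv/= => atT.
  have /andP[at_ _] := atT.
  exact: (measurable_wrt_ae_eq hG (le_trans a0 at_) (aL t tI) (LL' t atT)).
have mLt (X : R -> Omega -> R) t : adapted_on G `[a, T[ X -> a <= t < T ->
    measurable_fun setT (X t).
  move=> aX atT; have /andP[at_ _] := atT.
  by apply: (measurable_wrt_measurable hG (le_trans a0 at_)); apply: aX; rewrite /= in_itv.
have eqint t A : a <= t < T -> measurable A ->
    (\int[P]_(w in A) (L' t w)%:E = \int[P]_(w in A) (L t w)%:E)%E.
  move=> atT mA; apply: ae_eq_integral => //.
  - by apply/measurable_EFinP; apply: measurable_funTS; exact: mLt.
  - by apply/measurable_EFinP; apply: measurable_funTS; exact: mLt.
  - by apply: filterS (LL' t atT) => w -> _.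
split => // [t atT|s t as_ st tT A sA].
  apply/integrableP; split; first by apply/measurable_EFinP; exact: mLt.
  have /integrableP[_] := iL t atT.
  rewrite (@ae_eq_integral _ _ _ P setT (fun w => `|(L' t w)%:E|)%E)//.
  - by apply: measurableT_comp => //; apply/measurable_EFinP; exact: mLt.
  - by apply: measurableT_comp => //; apply/measurable_EFinP; exact: mLt.
  - by apply: filterS (LL' t atT) => w -> _.
have mA : measurable A by apply: (filtration_measurable hG (le_trans a0 as_)).
rewrite !eqint ?(le_trans as_ st)// ?as_ ?(le_lt_trans st)//.
exact: mL.
Qed.

Section ContinuousPaths.
Variables (a T : R) (h dh : R -> R) (L : R -> Omega -> R).
Hypotheses (a0 : 0 <= a) (hdh : forall b, a <= b < T -> primitive_on a b h dh).
Hypotheses (mL : martingale_on P G a T L).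
Hypothesis cL : forall w, {within `[a, T[, continuous (fun t => L t w)}.

Let integrable_exchange s t : a <= s -> s <= t -> t < T ->
  P.-integrable setT (fun w => (\int[mu]_(u in `[s, t]) (dh u * L u w))%:E) /\
  forall A, measurable A ->
    \int[P]_(w in A) \int[mu]_(u in `[s, t]) (dh u * L u w) =
    \int[mu]_(u in `[s, t]) (dh u * \int[P]_(w in A) L u w).
Proof.
move=> as_ st tT; have [aL iL _] := mL.
have sI u : s <= u <= t -> a <= u < T.
  by move=> /andP[su ut]; rewrite (le_trans as_ su) (le_lt_trans ut tT).
have [cdh _] : primitive_on s t h dh.
  by apply: (primitive_onS as_ (lexx t)); apply: hdh; rewrite (le_trans as_ st).
have [C C0 HC] := segment_bounded cdh.
(* Constant in time outside [[s, t]], hence jointly measurable on the whole product, and equal to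
   [dh u * L u w] on the segment. *)
pose f (p : R * Omega) := dh (clamp s t p.1) * L (clamp s t p.1) p.2.
have fE u w : u \in `[s, t] -> f (u, w) = dh u * L u w.
  by rewrite in_itv/= => ust; rewrite /f/= clampE.
have mf : measurable_fun setT f.
  apply: measurable_funM.
    have mk : measurable_fun setT (dh \o clamp s t).
      by apply: continuous_measurable_fun; exact: continuous_clamp.
    exact: (measurableT_comp mk measurable_fst).
  apply: (measurable_fun_continuous_sections (f := L)) => // [u ust|w].
    apply: (measurable_wrt_measurable hG (t := u)).
      by have /andP[au _] := sI _ ust; exact: le_trans au.
    by apply: aL; rewrite /= in_itv/= sI.
  by have := @cL w; apply: continuous_subspaceW; exact: sub_segment_co.
(* L^1 norms increase along the martingale, so the norm at the final time [t] serves for every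
   [u]. *)
have fB u : [set` `[s, t]] u ->
    (\int[P]_w `|f (u, w)|%:E <= (C * \int[P]_w `|L t w|)%:E)%E.
  move=> /= ust; have := ust; rewrite in_itv/= => ust'.
  have iu : P.-integrable setT (EFin \o L u) by apply: iL; exact: sI.
  have iu' : P.-integrable setT (fun w => `|L u w|%:E) by exact: (integrable_norm iu).
  have E w : (`|f (u, w)|%:E = `|dh u|%:E * `|L u w|%:E)%E by rewrite fE// normrM EFinM.
  under eq_integral do rewrite E.
  rewrite integralZl// -[X in (_ * X)%E]fineK; last exact: integrable_fin_num.
  rewrite -EFinM lee_fin ler_pM//.
  - by apply: fine_ge0; exact: integral_ge0.
  - exact: HC.
  have /andP[su ut] := ust'.
  exact: (martingale_L1_le a0 mL (le_trans as_ su) ut tT).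
have fi w : mu.-integrable `[s, t] (fun u => (f (u, w))%:E).
  have : mu.-integrable `[s, t] (EFin \o (fun u => dh u * L u w)).
    apply: segment_integrable; apply: within_continuousM => //.
    by have := @cL w; apply: continuous_subspaceW; exact: sub_segment_co.
  apply: eq_integrable => // u; rewrite inE => uI /=.
  by rewrite fE.
have B0 : 0 <= C * \int[P]_w `|L t w|.
  by rewrite mulr_ge0 ?(ltW C0)//; apply: Rintegral_ge0.
have mD : measurable (`[s, t] : set R) by exact: measurable_itv.
have Dfin : (mu `[s, t] < +oo)%E.
  by apply: compact_finite_measure; exact: segment_compact.
have FE w : \int[mu]_(u in `[s, t]) f (u, w) = \int[mu]_(u in `[s, t]) (dh u * L u w).
  by apply: eq_Rintegral => u; rewrite inE => uI; rewrite fE.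
split.
  rewrite (_ : (fun w => _) = (fun w => (\int[mu]_(u in `[s, t]) f (u, w))%:E)).
    exact: integrable_Rintegral_section mD Dfin B0 mf fB fi.
  by apply/funext => w; rewrite FE.
move=> A mA.
rewrite (@eq_Rintegral _ _ _ _ _ (fun w => \int[mu]_(u in `[s, t]) f (u, w))); last first.
  by move=> w _; rewrite FE.
rewrite (Rintegral_exchange mD Dfin B0 mf fB fi mA).
apply: eq_Rintegral => u; rewrite inE => uI.
rewrite -RintegralZl//; last first.
  apply: (@integrableS _ _ _ P setT) => //; apply: iL; apply: sI.
  by move: uI; rewrite /= in_itv.
by apply: eq_Rintegral => w _; rewrite fE.
Qed.

Lemma martingale_parts_int_continuous :
  martingale_on P G a T (fun t w => parts_int a h dh (fun s => L s w) t).
Proof.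
have [aL iL _] := mL.
have aN : adapted_on G `[a, T[ (fun t w => parts_int a h dh (fun s => L s w) t).
  by apply: (adapted_parts_int hG) => //; apply: aeW => w; exact: (@cL w).
have iN t : a <= t < T ->
    P.-integrable setT (EFin \o (fun w => parts_int a h dh (fun s => L s w) t)).
  move=> /andP[at_ tT].
  rewrite (_ : _ \o _ = (fun w => (h t)%:E * (L t w)%:E -
      (\int[mu]_(u in `[a, t]) (dh u * L u w))%:E)%E)//.
  apply: integrableB => //; last exact: (integrable_exchange (lexx a) at_ tT).1.
  by apply: integrableZl => //; apply: iL; rewrite at_.
split; [exact: aN|exact: iN|move=> s t as_ st tT A sA].
have mA : measurable A := filtration_measurable hG (le_trans a0 as_) sA.
have iS (f : Omega -> R) : P.-integrable setT (EFin \o f) -> P.-integrable A (EFin \o f).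
  by move=> fi; apply: integrableS fi.
have at_ := le_trans as_ st; have sT := le_lt_trans st tT.
have iNs := iN s; rewrite as_ sT in iNs; have {}iNs := iNs isT.
have iNt := iN t; rewrite at_ tT in iNt; have {}iNt := iNt isT.
suff key : \int[P]_(w in A) parts_int a h dh (fun s => L s w) t =
    \int[P]_(w in A) parts_int a h dh (fun s => L s w) s.
  exact: (etrans (EFin_Rintegral mA (iS _ iNt))
    (etrans (congr1 EFin key) (esym (EFin_Rintegral mA (iS _ iNs))))).
have iLu u : a <= u < T -> P.-integrable A (EFin \o L u) by move=> /iL; exact: iS.
have parts u : a <= u -> u < T -> \int[P]_(w in A) parts_int a h dh (fun s => L s w) u =
    h u * \int[P]_(w in A) L u w -
    \int[P]_(w in A) \int[mu]_(x in `[a, u]) (dh x * L x w).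
  move=> au uT; rewrite -RintegralZl//; last by apply: iLu; rewrite au.
  apply: RintegralB => //.
    rewrite (_ : _ \o _ = (fun w => (h u)%:E * (L u w)%:E)%E)//.
    by apply: integrableZl => //; apply: iLu; rewrite au.
  by apply: iS; exact: (integrable_exchange (lexx a) au uT).1.
rewrite (parts t at_ tT) (parts s as_ sT) (martingale_Rintegral a0 mL as_ st tT sA).
have -> : \int[P]_(w in A) \int[mu]_(x in `[a, t]) (dh x * L x w) =
   \int[P]_(w in A) \int[mu]_(x in `[a, s]) (dh x * L x w) +
   \int[P]_(w in A) \int[mu]_(x in `[s, t]) (dh x * L x w).
  rewrite -RintegralD//; last 2 first.
    by apply: iS; exact: (integrable_exchange (lexx a) as_ sT).1.
    by apply: iS; exact: (integrable_exchange as_ st tT).1.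
  apply: eq_Rintegral => w _; apply: Rintegral_cat => //.
  apply: segment_integrable; apply: within_continuousM.
    by apply: (hdh _).1; rewrite at_.
  by have := @cL w; apply: continuous_subspaceW; exact: sub_segment_co.
rewrite (integrable_exchange as_ st tT).2//.
(* The event [A] lies in [G s], so the inner expectation is frozen at time [s] and [dh] integrates
   to [h t - h s]. *)
have -> : \int[mu]_(u in `[s, t]) (dh u * \int[P]_(w in A) L u w) =
    \int[mu]_(u in `[s, t]) (dh u * \int[P]_(w in A) L s w).
  apply: eq_Rintegral => x; rewrite inE/= in_itv/= => /andP[sx xt].
  by rewrite (martingale_Rintegral a0 mL as_ sx (le_lt_trans xt tT) sA).
have pst : primitive_on s t h dh.
  by apply: (primitive_onS as_ (lexx t)); apply: hdh; rewrite at_.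
rewrite RintegralZr//; last by apply: segment_integrable; exact: pst.1.
rewrite pst.2//; ring.
Qed.

End ContinuousPaths.

Lemma martingale_parts_int a T h dh L : 0 <= a ->
  (forall b, a <= b < T -> primitive_on a b h dh) ->
  martingale_on P G a T L -> continuous_paths_on P `[a, T[ L ->
  martingale_on P G a T (fun t w => parts_int a h dh (fun s => L s w) t).
Proof.
move=> a0 hdh mL cL; have [N [mN PN cLN]] := aeE cL.
have NL t : {ae P, forall w, L t w = vanish_on N L t w}.
  exists N; split => // w /= H; apply: contrapT => Nw; apply: H.
  by rewrite /vanish_on; case: ifPn => //; rewrite inE.
have mL' := martingale_on_ae_eq a0 mL (fun t _ => NL t).
have := martingale_parts_int_continuous a0 hdh mL' (continuous_vanish_on cLN).
move=> /(martingale_on_ae_eq a0); apply => t _.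
exists N; split => // w /= H; apply: contrapT => Nw; apply: H.
rewrite /parts_int; congr (_ * _ - _); last apply: eq_Rintegral => s _.
  by rewrite /vanish_on; case: ifPn => //; rewrite inE.
by rewrite /vanish_on; case: ifPn => //; rewrite inE.
Qed.
End MartingaleTransform.

(** * Local martingales and semimartingales multiplied by [h] *)

Section Semimartingales.
Context {R : realType} {d : measure_display} {Omega : measurableType d}.
Variables (P : probability Omega R) (G : R -> set (set Omega)).
Hypothesis hG : usual_filtration P G.
Local Notation mu := (@lebesgue_measure R).
Variables (a T : R) (h dh : R -> R).
Hypotheses (a0 : 0 <= a) (hdh : forall b, a <= b < T -> primitive_on a b h dh).
Implicit Types (M X L : R -> Omega -> R).

Lemma continuous_paths_parts_int L : continuous_paths_on P `[a, T[ L ->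
  continuous_paths_on P `[a, T[ (fun t w => parts_int a h dh (fun s => L s w) t).
Proof.
apply: filterS => w cL; apply: within_continuous_itvco => b abT.
apply: parts_int_continuous; first exact: hdh.
by apply: continuous_subspaceW cL; apply: sub_segment_co => //; case/andP: abT.
Qed.

(** The same stopping times work, because the transform commutes with stopping path by path. *)
Lemma local_martingale_parts_int M : continuous_local_martingale_on P G a T M ->
  continuous_local_martingale_on P G a T
    (fun t w => parts_int a h dh (fun s => M s w) t).
Proof.
move=> [aM cM [tau [st tauS tauT mM]]]; split.
- exact: (adapted_parts_int hG).
- exact: continuous_paths_parts_int.
exists tau; split; [exact: st|exact: tauS|exact: tauT|move=> n].
have cMtau : {ae P, forall w,
    {within `[a, T[, continuous (fun t => M (Num.min t (tau n w)) w)}}.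
  apply: filterS cM => w cM; apply: within_continuous_min cM => x /=.
  rewrite !in_itv/= => /andP[ax xT].
  by rewrite le_min ax (st n).1/= gt_min xT.
apply: (martingale_on_ae_eq hG a0 (martingale_parts_int hG a0 hdh (mM n) cMtau)).
move=> t /andP[at_ tT]; apply: filterS cM => w cM.
apply: (parts_int_stop (b := t)); rewrite ?at_ ?lexx//.
- by apply: hdh; rewrite at_.
- by apply: continuous_subspaceW cM; exact: sub_segment_co.
- exact: (st n).1.
Qed.

Lemma adapted_mul X : adapted_on G `[a, T[ X ->
  adapted_on G `[a, T[ (fun t w => h t * X t w).
Proof.
move=> aX t tI; have t0 : 0 <= t.
  by apply: le_trans a0 _; move: tI; rewrite /= in_itv/= => /andP[].
have sG := filtration_sigma_algebra hG t0.
apply/measurable_wrtP => //; apply: measurable_funM => //.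
by apply/measurable_wrtP => //; exact: aX.
Qed.

Lemma continuous_paths_mul X : continuous_paths_on P `[a, T[ X ->
  continuous_paths_on P `[a, T[ (fun t w => h t * X t w).
Proof.
have ch : {within `[a, T[, continuous h}.
  by apply: within_continuous_itvco => b /hdh/primitive_continuous.
by apply: filterS => w cX; exact: within_continuousM.
Qed.

Lemma semimartingale_mul X : continuous_semimartingale_on P G a T X ->
  continuous_semimartingale_on P G a T (fun t w => h t * X t w).
Proof.
move=> [aX cX [M [A [lmM [aA cA bvA] MA0 XE]]]].
have ahX := adapted_mul aX; have chX := continuous_paths_mul cX.
split => //.
pose N t w := parts_int a h dh (fun s => M s w) t.
(* Defined as the remainder, so that the decomposition holds by construction and bounded variation
   is what must be earned. *)
pose B t w := h t * X t w - h a * X a w - N t w.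
have lmN : continuous_local_martingale_on P G a T N by exact: local_martingale_parts_int.
exists N, B; split => //; last 2 first.
- apply: filterS MA0 => w [M0 A0]; have Na : N a w = 0 by rewrite /N parts_intxx M0 mulr0.
  by rewrite /B Na subrr subr0.
- by apply: aeW => w t _; rewrite /B; ring.
have [aN cN _] := lmN; split.
- move=> t tI; have at_ : a <= t by move: tI; rewrite /= in_itv/= => /andP[].
  have t0 : 0 <= t by exact: le_trans at_.
  have sG := filtration_sigma_algebra hG t0.
  apply/measurable_wrtP => //; apply: measurable_funB; last by apply/measurable_wrtP => //; exact: aN.
  apply: measurable_funB; first by apply/measurable_wrtP => //; exact: ahX.
  apply/measurable_wrtP => //; apply: (measurable_wrt_le hG a0 at_); apply: ahX.
  rewrite /= in_itv/= lexx/=; apply: le_lt_trans at_ _.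
  by move: tI; rewrite /= in_itv/= => /andP[].
- apply: filterS2 chX cN => w chX cN.
  apply: within_continuousB => //; apply: within_continuousB => //.
  by apply: continuous_subspaceT => ?; exact: cvg_cst.
have cM : continuous_paths_on P `[a, T[ M by case: lmM.
apply: filterS2 (filterI cM cA) (filterI XE bvA) => w [{}cM {}cA] [{}XE {}bvA] b abT.
have /andP[ab bT] := abT.
have cMb : {within `[a, b], continuous (fun t => M t w)}.
  by apply: continuous_subspaceW cM; exact: sub_segment_co.
have cAb : {within `[a, b], continuous (fun t => A t w)}.
  by apply: continuous_subspaceW cA; exact: sub_segment_co.
have hab := hdh abT.
have [Ch Ch0 HCh] := segment_bounded (primitive_continuous hab).
have [CA CA0 HCA] := segment_bounded cAb.
have [Lh Lh0 HLh] := primitive_lipschitz hab.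
have [K K0 HK] := parts_int_integral_lipschitz hab.1 cMb.
have D0 : 0 <= `|X a w| * Lh + CA * Lh + K by rewrite !addr_ge0 ?mulr_ge0// ltW.
apply: (bounded_variation_increments ab (ltW Ch0) D0 (bvA b abT)).
move=> u v au uv vb.
have uT : a <= u < T by rewrite au (le_lt_trans uv (le_lt_trans vb bT)).
have vT : a <= v < T by rewrite (le_trans au uv) (le_lt_trans vb bT).
(* The products of [h] and [M] cancel: the martingale part survives only in a time integral, which
   is Lipschitz in its upper limit. *)
have -> : B v w - B u w = h v * (A v w - A u w) + (h v - h u) * X a w +
    (h v - h u) * A u w + (\int[mu]_(s in `[a, v]) (dh s * M s w) -
    \int[mu]_(s in `[a, u]) (dh s * M s w)).
  by rewrite /B /N /parts_int (XE v)// (XE u)//; ring.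
rewrite [leRHS](_ : _ = Ch * `|A v w - A u w| + `|X a w| * (Lh * (v - u)) +
  CA * (Lh * (v - u)) + K * (v - u)); last by ring.
apply: le_trans (ler_normD _ _) _; apply: lerD; last exact: HK.
apply: le_trans (ler_normD _ _) _; apply: lerD.
  apply: le_trans (ler_normD _ _) _; apply: lerD; rewrite normrM.
    by rewrite ler_wpM2r// HCh// (le_trans au uv).
  by rewrite mulrC ler_wpM2l// HLh.
by rewrite normrM mulrC ler_pM// ?HLh// HCA// au (le_trans uv vb).
Qed.

End Semimartingales.

(** * Uniform convergence in probability *)

Section UniformConvergenceInProbability.
Context {R : realType} {d : measure_display} {Omega : measurableType d}.
Variable P : probability Omega R.
Implicit Types (a b t e : R) (X : R -> Omega -> R) (Y : nat -> R -> Omega -> R).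

Lemma ucp_cvgP a b Y X : ucp_cvg P a b Y X <->
  forall e delta : R, 0 < e -> 0 < delta -> \forall n \near \oo,
    exists B : set Omega, [/\ measurable B, (P B <= delta%:E)%E
      & forall w, ~ B w -> forall t, a < t <= b -> `|Y n t w - X t w| < e].
Proof.
split => H e delta e0 delta0; apply: filterS (H e delta e0 delta0) => n.
  case=> B [mB PB] sB; exists B; split => // w Bw t tab.
  by rewrite ltNge; apply/negP => le; apply: Bw; apply: sB; exists t.
case=> B [mB PB] sB; exists B => // w /= [t tab le].
by apply: contrapT => /sB /(_ t tab); rewrite ltNge le.
Qed.

(** Domination is phrased with a common bound [M] of the two known errors, which avoids suprema over
    time. *)
Lemma ucp_cvg_dominated a b (C : R) Y X Y1 X1 Y2 X2 : 0 < C ->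
  ucp_cvg P a b Y1 X1 -> ucp_cvg P a b Y2 X2 ->
  {ae P, forall w, forall n (M : R),
    (forall t, a < t <= b -> `|Y1 n t w - X1 t w| <= M) ->
    (forall t, a < t <= b -> `|Y2 n t w - X2 t w| <= M) ->
    forall t, a < t <= b -> `|Y n t w - X t w| <= C * M} ->
  ucp_cvg P a b Y X.
Proof.
move=> C0 /ucp_cvgP H1 /ucp_cvgP H2 /aeE[N [mN PN HN]].
apply/ucp_cvgP => e delta e0 delta0.
(* The factor 2 makes the final bound strict; [delta] is shared between the two exceptional
   events. *)
have e'0 : 0 < e / (2 * C) by rewrite divr_gt0// mulr_gt0.
have delta'0 : 0 < delta / 2 by rewrite divr_gt0.
apply: filterS2 (H1 _ _ e'0 delta'0) (H2 _ _ e'0 delta'0) => n.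
move=> [B1 [mB1 PB1 HB1]] [B2 [mB2 PB2 HB2]].
exists (B1 `|` B2 `|` N); split.
- by apply: measurableU => //; exact: measurableU.
- rewrite measureU0//; last exact: measurableU.
  by apply: le_trans (measureU2 _ mB1 mB2) _; rewrite [delta]splitr EFinD leeD.
move=> w; rewrite !not_orP => -[[B1w B2w] Nw] t tab.
apply: (@le_lt_trans _ _ (C * (e / (2 * C)))).
  apply: (HN w Nw n) => // s sab; first exact/ltW/HB1.
  exact/ltW/HB2.
rewrite (_ : C * (e / (2 * C)) = e / 2); last by field; rewrite gt_eqF.
by rewrite ltr_pdivrMr// ltr_pMr// ltr1n.
Qed.

(** The event [B n] that some error of index at least [n] is large decreases to a null set, so its
    probability tends to 0 by continuity from above. *)
Lemma ucp_cvg_of_uniform a b Y X : a <= b ->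
  (forall n t, a <= t <= b -> measurable_fun setT (fun w => Y n t w - X t w)) ->
  {ae P, forall w, forall n, {within `[a, b], continuous (fun t => Y n t w - X t w)}} ->
  {ae P, forall w, forall e, 0 < e ->
    \forall n \near \oo, forall t, a <= t <= b -> `|Y n t w - X t w| < e} ->
  ucp_cvg P a b Y X.
Proof.
move=> ab mY /aeE[N1 [mN1 PN1 HN1]] /aeE[N2 [mN2 PN2 HN2]].
pose N := N1 `|` N2; have mN : measurable N by exact: measurableU.
have PN : P N = 0 by rewrite measureU0.
have cN w : ~ N w -> ~ N1 w /\ ~ N2 w by rewrite not_orP.
apply/ucp_cvgP => e delta e0 delta0.
(* Rational times keep the events measurable. The threshold [e / 2] leaves room for passing from an
   arbitrary time to a rational one by continuity. *)
pose E m (q : rat) :=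
  [set w | e / 2 < `|Y m (clamp a b (ratr q)) w - X (clamp a b (ratr q)) w|].
pose B n := \bigcup_(m in [set m | (n <= m)%N]) \bigcup_q E m q.
have mE m q : measurable (E m q).
  rewrite /E (_ : [set w | _] =
      (fun w => `|Y m (clamp a b (ratr q)) w - X (clamp a b (ratr q)) w|) @^-1` `]e / 2, +oo[).
    rewrite -[X in measurable X]setTI.
    have mf := measurableT_comp (@normr_measurable R setT) (mY m _ (clamp_itv (ratr q) ab)).
    by apply: mf.
  by apply/seteqP; split => w /=; rewrite in_itv/= andbT.
have mB n : measurable (B n).
  by apply: bigcup_measurable => m _; exact: bigcupT_measurable_rat.
have mIB : measurable (\bigcap_n B n) by exact: bigcapT_measurable.
have BN : \bigcap_n B n `<=` N.
  move=> w Bw; apply: contrapT => /cN[_ /HN2 /(_ (e / 2))].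
  rewrite divr_gt0// => /(_ isT)[n _ H].
  have [m /= nm [q _]] := Bw n I.
  by rewrite /E/= ltNge => /negP; apply; apply/ltW/H => //; exact: clamp_itv.
have PIB : P (\bigcap_n B n) = 0.
  by apply/eqP; rewrite -measure_le0 -PN; apply: le_measure; rewrite ?inE.
have ndB : nonincreasing_seq B.
  move=> n m nm; apply/subsetPset => w [k /= mk Ew]; exists k => //=.
  exact: leq_trans mk.
have PB0 : (P (B 0%N) < +oo)%E by rewrite ltey_eq fin_num_measure.
have cvgB : P \o B @ \oo --> 0%E by rewrite -PIB; exact: nonincreasing_cvg_mu.
have : \forall n \near \oo, (P (B n) < delta%:E)%E.
  have /fine_cvgP[_ /cvgrPdist_lt /(_ delta delta0)] := cvgB.
  apply: filterS => n /=; rewrite sub0r normrN => lt.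
  rewrite -[ltLHS]fineK ?fin_num_measure// lte_fin.
  exact: le_lt_trans (ler_norm _) lt.
apply: filterS => n PBn; exists (B n `|` N); split.
- exact: measurableU.
- by rewrite measureU0// ltW.
move=> w; rewrite not_orP => -[Bw Nw] t tab; have cw := HN1 w (cN w Nw).1.
rewrite ltNge; apply/negP => le.
have /within_continuousP/(_ t) := cw n.
have tab' : a <= t <= b by case/andP: tab => /ltW -> ->.
rewrite /= in_itv/= => /(_ tab' (e / 2)).
rewrite divr_gt0// => /(_ isT)[r r0 Hr].
(* This [q] may lie outside the segment, but clamping it does not increase its distance to [t]. *)
have [q] : exists q, ratr q \in `]t - r, t + r[ by apply: rat_in_itvoo; lra.
rewrite in_itv/= => /andP[q1 q2].
have := Hr (clamp a b (ratr q)); rewrite in_itv/= clamp_itv// => /(_ isT).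
have -> : `|t - clamp a b (ratr q)| < r.
  rewrite -{1}(clampE tab'); apply: le_lt_trans (clamp_lipschitz _ _ _ _) _.
  by rewrite ltr_norml; lra.
move=> /(_ isT).
have : ~ E n q w by move=> Ew; apply: Bw; exists n => //=; exists q.
rewrite /E/= => /negP; rewrite -leNgt => H1 H2.
move: H2; set y := Y n t w - X t w in le *; set z := (Y n (clamp _ _ _) w - _) in H1 *.
have := ler_normD (y - z) z; rewrite subrK.
by lra.
Qed.

End UniformConvergenceInProbability.

(** * Simple integrands multiplied by step approximations of [h] *)

Section ItoIntegral.
Context {R : realType} {d : measure_display} {Omega : measurableType d}.
Variables (P : probability Omega R) (G : R -> set (set Omega)).
Hypothesis hG : usual_filtration P G.
Implicit Types (a b t T : R) (h dh : R -> R) (Z K J : R -> Omega -> R).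
Implicit Types (S : @simple_integrand R d Omega) (n : nat).

(** A simple integrand has a single index; quotient and remainder encode the pair of an interval of
    [S] and a mesh cell. *)
Lemma sum_divmod (N m : nat) (F : nat -> nat -> R) :
  \sum_(j < N * m.+1) F (j %/ m.+1)%N (j %% m.+1)%N =
  \sum_(i < N) \sum_(k < m.+1) F i k.
Proof.
rewrite -(big_mkord xpredT (fun j => F (j %/ m.+1)%N (j %% m.+1)%N)) big_nat_mul big_mkord.
apply: eq_bigr => i _.
rewrite -[X in \sum_(X <= _ < _) _]add0n mulSn big_addn addnK big_mkord.
apply: eq_bigr => k _.
by rewrite addnC divnMDl// modnMDl divn_small// modn_small// addn0.
Qed.

(* The product of S with the step function of value h (mesh_point k) on the k-th
   mesh interval; the outer maximum turns an empty intersection of intervals into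
   a degenerate interval. *)
Definition mesh_integrand a b h n S : @simple_integrand R d Omega :=
  SimpleIntegrand (simple_size S * n.+1)
    (fun j => Num.max (simple_left S (j %/ n.+1)) (mesh_point a b n (j %% n.+1)))
    (fun j => Num.max
      (Num.max (simple_left S (j %/ n.+1)) (mesh_point a b n (j %% n.+1)))
      (Num.min (simple_right S (j %/ n.+1)) (mesh_point a b n (j %% n.+1).+1)))
    (fun j w => h (mesh_point a b n (j %% n.+1)) * simple_coef S (j %/ n.+1) w).

(** Left endpoints only move to the right, where the filtration is larger, and [h] is
    deterministic. *)
Lemma mesh_integrand_predictable a b h n S : 0 <= a -> a <= b ->
  simple_predictable G a b S -> simple_predictable G a b (mesh_integrand a b h n S).
Proof.
move=> a0 ab pS j /= jN.
have iN : (j %/ n.+1 < simple_size S)%N by rewrite ltn_divLR.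
have [al lr rb mc] := pS _ iN.
have /andP[_ kb] := mesh_point_itv ab (ltnW (ltn_pmod j (ltn0Sn n))).
split.
- by rewrite le_max al.
- by rewrite le_max lexx.
- by rewrite !ge_max kb (le_trans lr rb) ge_min rb.
set l := Num.max _ _.
have ll : simple_left S (j %/ n.+1) <= l by rewrite le_max lexx.
have l0 : 0 <= simple_left S (j %/ n.+1) by exact: le_trans al.
have sG := filtration_sigma_algebra hG (le_trans l0 ll).
apply/measurable_wrtP => //; apply: measurable_funM => //.
by apply/measurable_wrtP => //; exact: (measurable_wrt_le hG l0 ll).
Qed.

(** Integrating the indicator of []l, r]] times that of []u, v]] against [f] amounts to taking the
    increment over []u, v]] of the integral of the first indicator. *)
Lemma increment_interval_inter (f : R -> R) (l r u v t : R) : l <= r -> u <= v ->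
  f (Num.min (Num.max (Num.max l u) (Num.min r v)) t) -
    f (Num.min (Num.max l u) t) =
  (f (Num.min r (Num.min v t)) - f (Num.min l (Num.min v t))) -
  (f (Num.min r (Num.min u t)) - f (Num.min l (Num.min u t))).
Proof.
move=> lr uv; rewrite !minA.
(* When the intervals are disjoint the outer maximum gives a degenerate interval, and both sides
   vanish. *)
have [ru|ur] := leP r u.
  rewrite (min_idPl (le_trans ru uv)) (min_idPl (le_trans lr ru)).
  rewrite (min_idPl (le_trans lr (le_trans ru uv))) (max_idPr (le_trans lr ru)).
  by rewrite (max_idPl ru) !subrr.
have [vl|lv] := leP v l.
  rewrite (min_idPr (le_trans vl lr)) (min_idPr (le_trans uv vl)).
  by rewrite (max_idPl (le_trans uv vl)) (max_idPl vl) !subrr.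
rewrite [Num.max (Num.max l u) _](max_idPr _); last first.
  by rewrite ge_max !le_min lr (ltW lv) (ltW ur) uv.
have [lu|ul] := leP l u; first by ring.
by ring.
Qed.

Lemma simple_integral_mesh a b h n S Z t w : a <= b -> simple_predictable G a b S ->
  simple_integral (mesh_integrand a b h n S) Z t w =
  mesh_sum a b h (fun s => simple_integral S Z s w) n t.
Proof.
move=> ab pS; rewrite /simple_integral /=.
rewrite (sum_divmod (simple_size S) n (fun i k => h (mesh_point a b n k) * simple_coef S i w *
  (Z (Num.min (Num.max (Num.max (simple_left S i) (mesh_point a b n k))
     (Num.min (simple_right S i) (mesh_point a b n k.+1))) t) w -
   Z (Num.min (Num.max (simple_left S i) (mesh_point a b n k)) t) w))).
rewrite exchange_big; apply: eq_bigr => k _.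
rewrite -sumrB mulr_sumr; apply: eq_bigr => i _.
have [_ lr _ _] := pS i (ltn_ord i).
rewrite (increment_interval_inter (fun s => Z s w))//; last exact: mesh_point_le.
by ring.
Qed.

Definition mesh_indicator a b n (k : nat) t : R :=
  ((mesh_point a b n k < t) && (t <= mesh_point a b n k.+1))%:R.

Lemma simple_process_mesh a b h n S t w :
  simple_process (mesh_integrand a b h n S) t w =
  (\sum_(k < n.+1) h (mesh_point a b n k) * mesh_indicator a b n k t) *
  simple_process S t w.
Proof.
rewrite /simple_process /=.
rewrite (sum_divmod (simple_size S) n (fun i k => h (mesh_point a b n k) * simple_coef S i w *
  ((Num.max (simple_left S i) (mesh_point a b n k) < t) &&
   (t <= Num.max (Num.max (simple_left S i) (mesh_point a b n k))
     (Num.min (simple_right S i) (mesh_point a b n k.+1))))%:R)).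
rewrite exchange_big mulr_suml; apply: eq_bigr => k _.
rewrite mulr_sumr; apply: eq_bigr => i _.
rewrite /mesh_indicator gt_max le_max le_min le_max.
set x := simple_left S i; set y := mesh_point a b n k.
(* Only the four strict comparisons with [t] remain, and their truth table decides the identity. *)
rewrite !(leNgt t).
case: (x < t); case: (y < t); case: (simple_right S i < t);
  case: (mesh_point a b n k.+1 < t);
  by rewrite /= ?(mulr0, mul0r, mulr1).
Qed.

(** The indicator of a cell is the difference of the indicators of [t <= x] at its two ends, so the
    sum telescopes. The cells are open on the left and do not cover [a]. *)
Lemma sum_mesh_indicator a b n t : a < t <= b -> 
  \sum_(k < n.+1) mesh_indicator a b n k t = 1.
Proof.
move=> /andP[at_ tb]; have ab : a <= b := le_trans (ltW at_) tb.
pose s k : R := (t <= mesh_point a b n k)%R%:R.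
transitivity (\sum_(k < n.+1) (s k.+1 - s k)).
  apply: eq_bigr => k _; rewrite /mesh_indicator /s ltNge.
  have := mesh_point_le n ab (leqnSn k).
  case: (leP t (mesh_point a b n k)) => [h1 h2|_ _]; last by rewrite subr0.
  by rewrite (le_trans h1 h2) subrr.
rewrite -(big_mkord xpredT (fun k => s k.+1 - s k)) telescope_sumr//.
by rewrite /s mesh_point0 mesh_point_last tb leNgt at_ subr0.
Qed.

(** The cell indicators form a partition of unity, so both estimates reduce to one cell: [B] bounds
    the size of [h], and [L * (b - a)] the rate. *)
Lemma mesh_step_error a b h dh : a <= b -> primitive_on a b h dh ->
  exists2 C : R, 0 < C & forall n t, a < t <= b ->
  `|\sum_(k < n.+1) h (mesh_point a b n k) * mesh_indicator a b n k t| <= C /\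
  `|\sum_(k < n.+1) h (mesh_point a b n k) * mesh_indicator a b n k t - h t|
    <= C / n.+1%:R.
Proof.
move=> ab hdh.
have [B B0 HB] := segment_bounded (primitive_continuous hdh).
have [L L0 HL] := primitive_lipschitz hdh.
have Lba : 0 <= L * (b - a) by rewrite mulr_ge0 ?(ltW L0)// subr_ge0.
exists (B + L * (b - a)); first by rewrite ltr_wpDr.
move=> n t tab; have i0 k : 0 <= mesh_indicator a b n k t by [].
split.
  apply: le_trans (ler_norm_sum _ _ _) _.
  apply: (@le_trans _ _ (\sum_(k < n.+1) B * mesh_indicator a b n k t)).
    apply: ler_sum => k _; rewrite normrM (ger0_norm (i0 k)) ler_wpM2r//.
    by apply: HB; apply: mesh_point_itv => //; exact: ltnW.
  by rewrite -mulr_sumr sum_mesh_indicator// mulr1 lerDl.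
rewrite -[h t]mulr1 -(sum_mesh_indicator n tab) mulr_sumr -sumrB.
apply: le_trans (ler_norm_sum _ _ _) _.
apply: (@le_trans _ _ (\sum_(k < n.+1) (L * (b - a) / n.+1%:R) * mesh_indicator a b n k t)).
  apply: ler_sum => k _; rewrite -mulrBl normrM (ger0_norm (i0 k)).
  rewrite /mesh_indicator; case: (boolP (_ && _)) => [/andP[kt tk]|_]; last by rewrite !mulr0.
  rewrite !mulr1 distrC.
  have /andP[ak _] := mesh_point_itv ab (ltnW (ltn_ord k)).
  have /andP[at_ tb] := tab.
  apply: le_trans (HL _ _ ak (ltW kt) tb) _.
  rewrite -mulrA ler_wpM2l ?(ltW L0)// -(mesh_pointS a b n k).
  by rewrite lerD2r.
rewrite -mulr_sumr sum_mesh_indicator// mulr1 ler_pM2r ?invr_gt0//.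
by rewrite lerDr ltW.
Qed.

End ItoIntegral.

(** * The Ito integral of [h * K] *)

Section ItoIntegralMul.
Context {R : realType} {d : measure_display} {Omega : measurableType d}.
Variables (P : probability Omega R) (G : R -> set (set Omega)).
Hypothesis hG : usual_filtration P G.
Variables (a T : R) (h dh : R -> R).
Hypotheses (a0 : 0 <= a) (hdh : forall b, a <= b < T -> primitive_on a b h dh).
Implicit Types (b t : R) (Z K J : R -> Omega -> R).
Implicit Types (S : @simple_integrand R d Omega) (n : nat).

Let measurable_at X t : adapted_on G `[a, T[ X -> a <= t < T -> measurable_fun setT (X t).
Proof.
move=> aX atT; have /andP[at_ _] := atT.
by apply: (measurable_wrt_measurable hG (le_trans a0 at_)); apply: aX; rewrite /= in_itv.
Qed.

Lemma within_continuous_sum (A : set R) n (f : nat -> R -> R) :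
  (forall k, (k < n)%N -> {within A, continuous (f k)}) ->
  {within A, continuous (fun t => \sum_(k < n) f k t)}.
Proof.
elim: n => [|n IH] cf.
  rewrite (_ : (fun t => _) = fun=> 0); last by apply/funext => t; rewrite big_ord0.
  by apply: continuous_subspaceT => ?; exact: cvg_cst.
rewrite (_ : (fun t => _) = (fun t => \sum_(k < n) f k t + f n t)); last first.
  by apply/funext => t; rewrite big_ord_recr.
apply: within_continuousD; last exact: cf.
by apply: IH => k kn; apply: cf; exact: ltnW.
Qed.

Lemma within_continuous_mesh_sum b (f : R -> R) n : a <= b ->
  {within `[a, b], continuous f} -> {within `[a, b], continuous (mesh_sum a b h f n)}.
Proof.
move=> ab cf; apply: (within_continuous_sum (f := fun k t => h (mesh_point a b n k) *
  (f (Num.min (mesh_point a b n k.+1) t) - f (Num.min (mesh_point a b n k) t)))) => k kn.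
have cmin j : (j <= n.+1)%N ->
    {within `[a, b], continuous (fun t => f (Num.min (mesh_point a b n j) t))}.
  move=> jn; rewrite (_ : (fun t => _) = fun t => f (Num.min t (mesh_point a b n j))).
    apply: within_continuous_min cf => x /=; rewrite !in_itv/= => /andP[ax xb].
    by rewrite le_min ax ge_min xb andbT; have /andP[] := mesh_point_itv ab jn.
  by apply/funext => t; rewrite minC.
apply: within_continuousM.
  by apply: continuous_subspaceT => ?; exact: cvg_cst.
by apply: within_continuousB; apply: cmin => //; exact: ltnW.
Qed.

Lemma simple_integral_start b S Z w : simple_predictable G a b S ->
  simple_integral S Z a w = 0.
Proof.
move=> pS; apply: big1 => i _; have [al lr _ _] := pS i (ltn_ord i).
by rewrite (min_idPr al) (min_idPr (le_trans al lr)) subrr mulr0.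
Qed.

Let ucp_mesh_process b K (S : nat -> @simple_integrand R d Omega) : a < b < T ->
  adapted_on G `[a, T[ K -> continuous_paths_on P `[a, T[ K ->
  ucp_cvg P a b (fun n => simple_process (S n)) K ->
  ucp_cvg P a b (fun n => simple_process (mesh_integrand a b h n (S n)))
    (fun t w => h t * K t w).
Proof.
move=> /andP[ab bT] aK cK cS.
have abT : a <= b < T by rewrite ltW.
have [C C0 HC] := mesh_step_error (ltW ab) (hdh abT).
(* Replacing [h] by its step approximation costs at most [C * |K| / n.+1]; this sequence is the
   second input of the domination lemma. *)
have cK0 : ucp_cvg P a b (fun n t w => K t w / n.+1%:R) (fun _ _ => 0).
  apply: ucp_cvg_of_uniform (ltW ab) _ _ _.
  - move=> n t /andP[at_ tb].
    rewrite (_ : (fun w => _) = (fun w => K t w / n.+1%:R)); last first.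
      by apply/funext => w; rewrite subr0.
    apply: measurable_funM; last exact: measurable_cst.
    by apply: measurable_at => //; rewrite at_ (le_lt_trans tb).
  - apply: filterS cK => w cK n.
    rewrite (_ : (fun t => _) = (fun t => K t w / n.+1%:R)); last first.
      by apply/funext => t; rewrite subr0.
    apply: within_continuousM.
      by apply: continuous_subspaceW cK; exact: sub_segment_co.
    by apply: continuous_subspaceT => ?; exact: cvg_cst.
  apply: filterS cK => w cK e e0.
  have cKb : {within `[a, b], continuous (fun t => K t w)}.
    by apply: continuous_subspaceW cK; exact: sub_segment_co.
  have [B B0 HB] := segment_bounded cKb.
  near=> n => t tab; rewrite subr0 normrM normfV normr_nat ltr_pdivrMr//.
  apply: le_lt_trans (HB _ tab) _; rewrite mulrC -ltr_pdivrMr//.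
  have : B / e < n%:R by near: n; exact: nbhs_infty_gtr.
  by move=> /lt_le_trans; apply; rewrite ler_nat.
apply: (@ucp_cvg_dominated _ _ _ _ a b (C + C) _ _ _ _ _ _ _ cS cK0); first by rewrite addr_gt0.
apply: aeW => w n M H1 H2 t tab; have {HC}[HC1 HC2] := HC n t tab.
rewrite simple_process_mesh.
move: HC1 HC2; set c := \sum_(k < n.+1) _ => HC1 HC2.
rewrite (_ : c * _ - _ = c * (simple_process (S n) t w - K t w) + (c - h t) * K t w); last by ring.
rewrite [(C + C) * M]mulrDl.
apply: le_trans (ler_normD _ _) _; apply: lerD; rewrite normrM.
  by apply: ler_pM => //; exact: H1.
apply: (@le_trans _ _ (C / n.+1%:R * `|K t w|)); first exact: ler_wpM2r.
have := H2 t tab; rewrite subr0 normrM normfV normr_nat => H3.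
by rewrite mulrAC -mulrA ler_wpM2l// ltW.
Unshelve. all: by end_near. Qed.

Let ucp_mesh_integral b Z J (S : nat -> @simple_integrand R d Omega) : a < b < T ->
  adapted_on G `[a, T[ J -> continuous_paths_on P `[a, T[ J ->
  {ae P, forall w, J a w = 0} ->
  (forall n, simple_predictable G a b (S n)) ->
  ucp_cvg P a b (fun n => simple_integral (S n) Z) J ->
  ucp_cvg P a b (fun n => simple_integral (mesh_integrand a b h n (S n)) Z)
    (fun t w => parts_int a h dh (fun s => J s w) t).
Proof.
move=> /andP[ab bT] aJ cJ J0 pS cS.
have abT : a <= b < T by rewrite ltW.
have hab := hdh abT.
have [C C0 HC] := mesh_sum_bounded (ltW ab) hab.
have aJ' := adapted_parts_int hG a0 hdh aJ cJ.
have cJb : {ae P, forall w, {within `[a, b], continuous (fun t => J t w)}}.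
  by apply: filterS cJ => w; apply: continuous_subspaceW; exact: sub_segment_co.
have cR : ucp_cvg P a b (fun n t w => mesh_sum a b h (fun s => J s w) n t)
    (fun t w => parts_int a h dh (fun s => J s w) t).
  apply: ucp_cvg_of_uniform (ltW ab) _ _ _.
  - move=> n t /andP[at_ tb]; have atT : a <= t < T by rewrite at_ (le_lt_trans tb).
    apply: measurable_funB; last exact: (measurable_at aJ').
    apply: measurable_sum => k; apply: measurable_funM => //.
    have mJ j : (j <= n.+1)%N -> measurable_fun setT (J (Num.min (mesh_point a b n j) t)).
      move=> jn; have /andP[aj jb] := mesh_point_itv (ltW ab) jn.
      by apply: (measurable_at aJ); rewrite le_min aj at_/= gt_min (le_lt_trans jb bT).
    by apply: measurable_funB; apply: mJ => //; exact: ltnW.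
  - apply: filterS cJb => w cJw n; apply: within_continuousB.
      by apply: within_continuous_mesh_sum => //; exact: ltW.
    exact: parts_int_continuous.
  apply: filterS2 cJb J0 => w cJw J0w e e0.
  have := mesh_sum_cvg (ltW ab) hab cJw e0.
  by rewrite parts_intxx J0w mulr0; apply: filterS => n H t /H; rewrite subr0.
apply: (@ucp_cvg_dominated _ _ _ _ a b (C + 1) _ _ _ _ _ _ _ cS cR).
  by rewrite addr_gt0.
apply: filterS J0 => w J0w n M H1 H2 t tab.
have /andP[at_ tb] := tab; have tab' : a <= t <= b by rewrite ltW.
rewrite (simple_integral_mesh h n Z t w (ltW ab) (pS n)).
(* Mesh sums are linear in the integrator: the first term is bounded by the error of the simple
   integrals, uniformly in the mesh, and the second is the mesh error for the fixed path [J]. *)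
rewrite (_ : _ - _ = mesh_sum a b h (fun s => simple_integral (S n) Z s w - J s w) n t +
  (mesh_sum a b h (fun s => J s w) n t - parts_int a h dh (fun s => J s w) t)); last first.
  rewrite addrA; congr (_ - _); rewrite /mesh_sum -big_split/=.
  by apply: eq_bigr => k _; ring.
rewrite [(C + 1) * M]mulrDl mul1r.
apply: le_trans (ler_normD _ _) _; apply: lerD; last exact: H2.
apply: HC => // s /andP[as_ st].
(* The hypothesis on [M] concerns []a, b]] only; at [a] itself both integrals vanish. *)
move: as_; rewrite le_eqVlt => /predU1P[<-|as_].
  rewrite (simple_integral_start Z w (pS n)) J0w subrr normr0.
  exact: le_trans (H1 t tab).
by apply: H1; rewrite as_ (le_trans st tb).
Qed.

(** Starting [J] at 0 removes the boundary term [h a * J a] contained in [parts_int]. *)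
Lemma ito_integral_mul K Z J : ito_integral_on P G a T K Z J ->
  {ae P, forall w, J a w = 0} ->
  ito_integral_on P G a T (fun t w => h t * K t w) Z
    (fun t w => parts_int a h dh (fun s => J s w) t).
Proof.
move=> [[aK cK] [aJ cJ] HS] J0; split.
- by split; [exact: (adapted_mul hG)|exact: (continuous_paths_mul hdh)].
- by split; [exact: (adapted_parts_int hG)|exact: continuous_paths_parts_int].
move=> b abT; have [S [pS cp ci]] := HS b abT.
have ab : a <= b by case/andP: abT => /ltW.
exists (fun n => mesh_integrand a b h n (S n)); split.
- by move=> n; exact: (mesh_integrand_predictable hG).
- exact: ucp_mesh_process.
- exact: ucp_mesh_integral.
Qed.

End ItoIntegralMul.

(** * The spatial identity for the logarithmic drift *)

Section DriftIdentity.
Context {R : realType}.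
Implicit Types (f g : R -> R) (x y l m : R).

Lemma is_derive_derive1 f x (l : R) : is_derive x 1 f l -> derive1 f x = l.
Proof. by move=> Hf; rewrite derive1E derive_val. Qed.

Lemma derivable_is_derive1 f x : derivable f x 1 -> is_derive x 1 f (derive1 f x).
Proof. by move=> df; rewrite derive1E; exact: derivableP. Qed.

Lemma is_derive1M f g x (l m : R) : is_derive x 1 f l -> is_derive x 1 g m ->
  is_derive x 1 (fun y => f y * g y) (f x * m + g x * l).
Proof. by move=> ? ?; exact: (is_deriveM (f := f) (g := g)). Qed.

Lemma is_derive_continuous f x (l : R) : is_derive x 1 f l -> {for x, continuous f}.
Proof. by move=> [df _]; exact/differentiable_continuous/derivable1_diffP. Qed.

Variables u u1 u2 f : R -> R.
Hypotheses (du : forall y, is_derive y 1 u (u1 y)).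
Hypotheses (du1 : forall y, is_derive y 1 u1 (u2 y)).
Hypotheses (Df : twice_continuously_differentiable f).

Let f1 := derive1 f.
Let f2 := derive1 f1.

Let df y : is_derive y 1 f (f1 y).
Proof. by case: Df => /(_ y) /derivable_is_derive1. Qed.

Let df1 y : is_derive y 1 f1 (f2 y).
Proof. by case: Df => _ /(_ y) /derivable_is_derive1. Qed.

Lemma derive1_twiceM :
  derive1 (fun y => u y * f y) = (fun y => u y * f1 y + f y * u1 y) /\
  derive1 (derive1 (fun y => u y * f y)) =
    (fun y => u y * f2 y + 2 * u1 y * f1 y + u2 y * f y).
Proof.
have E1 : derive1 (fun y => u y * f y) = (fun y => u y * f1 y + f y * u1 y).
  by apply/funext => y; apply: is_derive_derive1; exact: is_derive1M.
split => //; rewrite E1; apply/funext => y; apply: is_derive_derive1.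
have := is_deriveD (is_derive1M (du y) (df1 y)) (is_derive1M (df y) (du1 y)).
by congr is_derive; ring.
Qed.

Lemma twice_continuously_differentiableM : continuous u2 ->
  twice_continuously_differentiable (fun y => u y * f y).
Proof.
move=> cu2; have [E1 E2] := derive1_twiceM; split.
- by move=> y; have [] := is_derive1M (du y) (df y).
- move=> y; rewrite E1.
  by have [] := is_deriveD (is_derive1M (du y) (df1 y)) (is_derive1M (df y) (du1 y)).
rewrite E2 => y; have [_ _ cf2] := Df.
have cu : {for y, continuous u} := is_derive_continuous (du y).
have cu1 : {for y, continuous u1} := is_derive_continuous (du1 y).
have cf : {for y, continuous f} := is_derive_continuous (df y).
have cf1 : {for y, continuous f1} := is_derive_continuous (df1 y).
apply: cvgD; last by apply: cvgM => //; exact: cu2.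
apply: cvgD; first by apply: cvgM => //; exact: cf2.
by apply: cvgM => //; apply: cvgM => //; exact: cvg_cst.
Qed.

(** Since [u] times the derivative of [ln u] is [u1], the flux is [u1 * f]. Its derivative cancels
    the cross term [u1 * f1] of half the second derivative of [u * f] and reverses the sign of
    [2^-1 * u2 * f]. *)
Lemma log_drift_identity x : (forall y, 0 < u y) ->
  - derive1 (fun y => derive1 (fun z => ln (u z)) y * (u y * f y)) x +
    2^-1 * derive1 (derive1 (fun y => u y * f y)) x =
  - (2^-1 * u2 x) * f x + u x * (2^-1 * f2 x).
Proof.
move=> u0; have [_ ->] := derive1_twiceM.
have -> : (fun y => derive1 (fun z => ln (u z)) y * (u y * f y)) =
    (fun y => u1 y * f y).
  apply/funext => y.
  have dln : is_derive y 1 (fun z => ln (u z)) ((u y)^-1 * u1 y).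
    exact: (@is_derive1_comp _ (@ln R) u y _ _ (is_derive1_ln (u0 y)) (du y)).
  rewrite (is_derive_derive1 dln).
  by field; rewrite gt_eqF.
rewrite (is_derive_derive1 (is_derive1M (du1 x) (df x))).
by rewrite /f1; field.
Qed.

End DriftIdentity.

(** * Regularity of [H] on the strip and the heat equation *)

Section SmoothStrip.
Context {R : realType}.
Local Notation mu := (@lebesgue_measure R).
Variables (T : R) (H : R -> R -> R) (D : nat -> nat -> R -> R -> R).
Hypothesis DH : forall x t : R, 0 <= t < T -> D 0%N 0%N x t = H x t.
Hypothesis Dx : forall i j (x t : R), 0 <= t < T ->
  is_derive x (1 : R) (fun y => D i j y t) (D i.+1 j x t).
Hypothesis Dt : forall i j (x t : R), 0 < t < T ->
  is_derive t (1 : R) (fun s => D i j x s) (D i j.+1 x t).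

Lemma strip_is_derive_x (x t : R) : 0 <= t < T ->
  is_derive x (1 : R) (fun y => H y t) (D 1%N 0%N x t).
Proof.
move=> t0T; have := Dx 0%N 0%N x t0T.
by rewrite (_ : (fun y => D 0 0 y t) = fun y => H y t)//; apply/funext => y; exact: DH.
Qed.

Lemma strip_is_derive_t (x t : R) : 0 < t < T ->
  is_derive t (1 : R) (H x) (D 0%N 1%N x t).
Proof.
(* In time, [D 0 0] and [H] agree only inside the strip, so the derivative is transported by
   equality near [t]. *)
move=> tT; apply: (near_eq_is_derive _ (Dt 0%N 0%N x tT)).
have : t \in `]0, T[ by rewrite in_itv.
move=> /near_in_itvoo; apply: filterS => s; rewrite in_itv/= => /andP[/ltW s0 sT].
by rewrite DH// s0.
Qed.

(** The fundamental theorem of calculus; [0 < a] keeps the segment where the time derivatives are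
    two-sided. Continuity of [D 0 1] in time comes from its own differentiability. *)
Lemma strip_primitive (x a b : R) : 0 < a -> b < T ->
  primitive_on a b (H x) (D 0%N 1%N x).
Proof.
move=> a0 bT.
have inT t : a <= t <= b -> 0 < t < T.
  by move=> /andP[at_ tb]; rewrite (lt_le_trans a0 at_) (le_lt_trans tb bT).
have cD u v : a <= u -> v <= b -> {within `[u, v], continuous (D 0%N 1%N x)}.
  move=> au vb; apply: continuous_in_subspaceT => t; rewrite inE/= in_itv/= => /andP[ut tv].
  apply: is_derive_continuous (Dt 0%N 1%N x (inT t _)).
  by rewrite (le_trans au ut) (le_trans tv vb).
split=> [|u v au uv vb]; first exact: cD.
move: uv; rewrite le_eqVlt => /predU1P[<-|uv].
  by rewrite set_itv1 Rintegral_set1 subrr.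
have cH t : a <= t <= b -> {for t, continuous (H x)}.
  by move=> /inT /strip_is_derive_t /is_derive_continuous.
rewrite /Rintegral (continuous_FTC2 (F := H x) uv (cD _ _ au vb))//.
- split.
  + move=> t; rewrite in_itv/= => /andP[ut tv].
    have [] := @strip_is_derive_t x t (inT t _) => //.
    by rewrite ?(le_trans au (ltW ut)) ?(le_trans (ltW tv) vb).
  + by apply: cvg_at_right_filter; apply: cH; rewrite au (le_trans (ltW uv) vb).
  + by apply: cvg_at_left_filter; apply: cH; rewrite vb (le_trans au (ltW uv)).
move=> t; rewrite in_itv/= => /andP[ut tv]; apply: is_derive_derive1.
by apply: strip_is_derive_t; apply: inT; rewrite (le_trans au (ltW ut)) (le_trans (ltW tv) vb).
Qed.

Hypothesis Hpos : forall x t : R, 0 <= t < T -> 0 < H x t.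
Hypothesis Hheat : forall x t : R, 0 < t < T ->
  derive1 (H x) t + 2^-1 * derive1 (derive1 (fun y => H y t)) x = 0.

Lemma strip_heat (x t : R) : 0 < t < T -> D 0%N 1%N x t = - (2^-1 * D 2%N 0%N x t).
Proof.
move=> tT; have t0T : 0 <= t < T by case/andP: tT => /ltW ->.
have := Hheat x tT; rewrite (is_derive_derive1 (strip_is_derive_t x tT)).
rewrite (_ : derive1 (fun y => H y t) = fun y => D 1 0 y t); last first.
  by apply/funext => y; exact/is_derive_derive1/strip_is_derive_x.
rewrite (is_derive_derive1 (Dx 1%N 0%N x t0T)) => /eqP.
by rewrite addr_eq0 => /eqP.
Qed.

(** The heat equation turns the leftover half second derivative of [H] into the time derivative, the
    very term that the product rule in time produces. *)
Lemma zakai_drift_strip d (Omega : measurableType d) (psi : R -> R -> Omega -> R)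
    (x t : R) (w : Omega) : 0 < t < T ->
  twice_continuously_differentiable (fun y => psi y t w) ->
  zakai_drift (fun x t => derive1 (fun y => ln (H y t)) x)
    (fun x t w => H x t * psi x t w) x t w =
  D 0%N 1%N x t * psi x t w + H x t * zakai_drift (fun _ _ => 0) psi x t w.
Proof.
move=> tT tcd; have t0T : 0 <= t < T by case/andP: tT => /ltW ->.
rewrite /zakai_drift.
rewrite (log_drift_identity (u := fun y => H y t) (u1 := fun y => D 1%N 0%N y t)
  (u2 := fun y => D 2%N 0%N y t) _ _ tcd).
- rewrite strip_heat//; congr (_ + _ * _).
  rewrite (_ : (fun y => 0 * _) = fun=> 0); last by apply/funext => y; rewrite mul0r.
  by rewrite derive1_cst oppr0 add0r.
- by move=> y; exact: strip_is_derive_x.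
- by move=> y; exact: Dx.
- by move=> y; exact: Hpos.
Qed.

End SmoothStrip.

Theorem proposition4 (R : realType) (d : measure_display)
    (Omega : measurableType d) (P : probability Omega R)
    (F G : R -> set (set Omega))
    (T omega sigma x0 : R) (g H : R -> R -> R)
    (W1 W2 X Z : R -> Omega -> R) (psi : R -> R -> Omega -> R)
    (hT : 0 < T) (homega : 0 < omega) (hsigma : 0 < sigma)
    (Hsmooth : smooth_on_strip T H)
    (Hpos : forall x t, 0 <= t < T -> 0 < H x t)
    (Hheat : forall x t, 0 < t < T ->
       derive1 (H x) t + 2^-1 * derive1 (derive1 (fun y => H y t)) x = 0)
    (hF : usual_filtration P F)
    (hZ : filtering_problem P F T omega sigma x0 g W1 W2 X Z)
    (hG : usual_filtration P G)
    (hGF : forall t, 0 <= t -> G t `<=` F t)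
    (hGZ : adapted_on G `[0, T[ Z)
    (hpsi : zakai_solution P G T omega sigma (fun _ _ => 0) Z psi) :
  zakai_solution P G T omega sigma
    (fun x t => derive1 (fun y => ln (H y t)) x) Z
    (fun x t w => H x t * psi x t w).
Proof.
have [D [DH _ Dx Dt]] := Hsmooth; have [tcd sm eqn] := hpsi.
have prim x a : 0 < a -> forall b, a <= b < T -> primitive_on a b (H x) (D 0%N 1%N x).
  by move=> a0 b /andP[_ bT]; exact: (strip_primitive DH Dt).
split.
- apply: filterS tcd => w tcd t tT.
  have t0T : 0 <= t < T by case/andP: tT => /ltW ->.
  apply: (twice_continuously_differentiableM (u := fun y => H y t)
    (fun y => strip_is_derive_x DH Dx y t0T) (fun y => Dx 1%N 0%N y t t0T) (tcd t tT)).
  by move=> y; exact: is_derive_continuous (Dx 2%N 0%N y t t0T).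
- move=> x a aT; have /andP[a0 _] := aT.
  exact: (semimartingale_mul hG (ltW a0) (prim x a a0) (sm x a aT)).
move=> x a aT; have [J [itoJ eqJ]] := eqn x a aT; have /andP[a0 aT'] := aT.
exists (fun t w => parts_int a (H x) (D 0%N 1%N x) (fun s => J s w) t); split.
  rewrite (_ : (fun t w => _) = (fun t w => H x t * (omega * x / sigma ^+ 2 * psi x t w))).
    apply: (ito_integral_mul hG (ltW a0) (prim x a a0) itoJ).
    (* Read at [t = a], where the time integral runs over a point, the equation forces
       [J a w = 0]. *)
    apply: filterS eqJ => w /(_ a); rewrite lexx aT' => /(_ isT)[_].
    by rewrite set_itv1 Rintegral_set1 addr0 -{1}[psi x a w]addr0 => /addrI.
  by apply/funext => t; apply/funext => w; ring.
have [_ [_ cJ] _] := itoJ; have [_ cpsi _] := sm x a aT.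
apply: filterS3 (filterI tcd eqJ) cJ cpsi => w [{}tcd {}eqJ] {}cJ {}cpsi t atT.
have /andP[at_ tT] := atT.
have sub := sub_segment_co (lexx a) tT.
have ht := prim x a a0 t atT.
have [iphi _] := eqJ t atT.
set phi := fun s => zakai_drift (fun _ _ => 0) psi x s w in iphi.
have cpsit : {within `[a, t], continuous (fun s => psi x s w)}.
  exact: continuous_subspaceW cpsi.
have cJt : {within `[a, t], continuous (fun s => J s w)}.
  exact: continuous_subspaceW cJ.
have cDpsi := within_continuousM ht.1 cpsit.
have cDJ := within_continuousM ht.1 cJt.
have iDpsi := segment_integrable cDpsi.
have iHphi := segment_integrableM (primitive_continuous ht) iphi.
have driftE s : s \in `[a, t] ->
    zakai_drift (fun x t => derive1 (fun y => ln (H y t)) x)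
      (fun x t w => H x t * psi x t w) x s w =
    D 0%N 1%N x s * psi x s w + H x s * phi s.
  rewrite in_itv/= => /andP[as_ st].
  have sT : 0 < s < T by rewrite (lt_le_trans a0 as_) (le_lt_trans st tT).
  exact: (zakai_drift_strip DH Dx Dt Hpos Hheat x sT (tcd s sT)).
have J0 : J a w = 0.
  have := (eqJ a _).2; rewrite lexx aT' => /(_ isT).
  by rewrite set_itv1 Rintegral_set1 addr0 -{1}[psi x a w]addr0 => /addrI.
split.
  have : lebesgue_measure.-integrable `[a, t]
      (fun s => ((D 0%N 1%N x s * psi x s w)%:E + (H x s * phi s)%:E)%E).
    exact: integrableD.
  by apply: eq_integrable => // s; rewrite inE => sI; rewrite driftE.
have -> : \int[lebesgue_measure]_(s in `[a, t])
    zakai_drift (fun x t => derive1 (fun y => ln (H y t)) x)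
      (fun x t w => H x t * psi x t w) x s w =
    \int[lebesgue_measure]_(s in `[a, t]) (D 0%N 1%N x s * psi x s w) +
    \int[lebesgue_measure]_(s in `[a, t]) (H x s * phi s).
  rewrite -RintegralD//; apply: eq_Rintegral => s; rewrite inE => sI.
  by rewrite driftE.
(* Integration by parts is applied to [psi - J], the absolutely continuous part of the path, with
   density [phi]; what it leaves in [J] recombines into the new stochastic integral. *)
rewrite (@parts_int_indefinite _ a t (H x) (D 0%N 1%N x)
  (fun s => psi x s w - J s w) phi)//; last first.
  move=> s /andP[as_ st]; rewrite J0 subr0.
  by rewrite (eqJ s _).2 ?as_ ?(le_lt_trans st tT)//; ring.
rewrite parts_intxx J0 /parts_int.
have -> : \int[lebesgue_measure]_(s in `[a, t]) (D 0%N 1%N x s * (psi x s w - J s w)) =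
    \int[lebesgue_measure]_(s in `[a, t]) (D 0%N 1%N x s * psi x s w) -
    \int[lebesgue_measure]_(s in `[a, t]) (D 0%N 1%N x s * J s w).
  rewrite -RintegralB//; last exact: segment_integrable.
  by apply: eq_Rintegral => s _; ring.
by ring.
Qed.
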